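(* Let $\ell\ge1$ be an integer and let $p=cn^{-1}$ for some fixed $c>0$. Let $G_{n,p}$ be an Erdős–Rényi graph with parameters $n$ and $p$. Then $$\lim_{n\to\infty}\frac{\mathbb{E}[\chi_\ell(G_{n,p})]}{n}=(-1)^\ell c.$$ Moreover, for any $\varepsilon>0$, $$\lim_{n\to\infty}\mathbb{P}\left(\left|\frac{\chi_\ell(G_{n,p})}{n}-(-1)^\ell c\right|>\varepsilon\right)=0.$$
   Context: The Erdős–Rényi graph $G_{n,p}$ is the random graph on $n$ labelled vertices in which each pair of distinct vertices is joined by an edge independently with probability $p$. A graph means a finite simple undirected graph without loops. In a graph $G$ with vertex set $V(G)$, let $d(x,y)$ be the length of a shortest path between $x$ and $y$ ($\infty$ if there is none), and $L(x_0,\dots,x_k)=\sum_{i=1}^k d(x_{i-1},x_i)$. For integers $k,\ell\ge 0$, $\mathrm{MC}_{k,\ell}(G)$ is the free $\mathbb{Z}$-module generated by the tuples $(x_0,\dots,x_k)\in V(G)^{k+1}$ with $x_{i-1}\ne x_i$ for all $1\le i\le k$ and $L(x_0,\dots,x_k)=\ell$; $\mathrm{MC}_{-1,\ell}(G)=0$. The boundary map $\partial_{k,\ell}:\mathrm{MC}_{k,\ell}(G)\to\mathrm{MC}_{k-1,\ell}(G)$ is given for $k\ge1$ by $\partial_{k,\ell}(x_0,\dots,x_k)=\sum_{i} (-1)^i (x_0,\dots,\hat{x}_i,\dots,x_k)$, the sum over those $1\le i\le k-1$ with $d(x_{i-1},x_{i+1})=d(x_{i-1},x_i)+d(x_i,x_{i+1})$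 (the hat means deletion), and $\partial_{0,\ell}=0$. The magnitude homology is $\mathrm{MH}_{k,\ell}(G)=\ker\partial_{k,\ell}/\mathrm{Im}\,\partial_{k+1,\ell}$. For $\ell\ge0$, $\chi_\ell(G)=\sum_{k=0}^{\ell}(-1)^k\,\mathrm{rk}(\mathrm{MH}_{k,\ell}(G))$, where $\mathrm{rk}$ is the rank of a finitely generated abelian group; this is the coefficient of $q^\ell$ in the magnitude $\#G(q)=\sum_{\ell\ge0}\left(\sum_{k=0}^{\ell}(-1)^k\,\mathrm{rk}(\mathrm{MH}_{k,\ell}(G))\right)q^\ell\in\mathbb{Z}[[q]]$ of $G$. *)

(* Defs.v *)
From HB Require Import structures.
From mathcomp Require Import all_boot all_order all_algebra ring_quotient.
From mathcomp Require Import all_classical all_reals all_analysis.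

Set Implicit Arguments.
Unset Strict Implicit.
Unset Printing Implicit Defensive.

Import Order.TTheory GRing.Theory Num.Theory.
Import numFieldNormedType.Exports.

Local Open Scope classical_set_scope.
Local Open Scope ring_scope.

Definition vpairs (V : finType) : {set {set V}} := [set e : {set V} | #|e| == 2%N]%SET.

(* A graph is given by its edge set, a set of two-element sets of vertices. *)
Record sgraph (V : finType) := SGraph {
  edges : {set {set V}};
  edgesP : edges \subset vpairs V }.

HB.instance Definition _ (V : finType) := [isSub for @edges V].
HB.instance Definition _ (V : finType) := [Finite of sgraph V by <:].

(* If x = y then [set x; y] is a singleton, hence not an edge. *)
Definition adj (V : finType) (G : sgraph V) : rel V :=
  fun x y => [set x; y]%SET \in edges G.

Definition has_path (V : finType) (G : sgraph V) (x y : V) (k : nat) : bool :=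
  [exists s : k.-tuple V, [&& path (adj G) x s, uniq (x :: s) & last x s == y]].

(* Distances live in nat + {oo}, with [None] standing for oo. *)
Definition dist (V : finType) (G : sgraph V) (x y : V) : option nat :=
  if pselect (exists k, has_path G x y k) is left h then Some (ex_minn h) else None.

Definition oaddn (a b : option nat) : option nat :=
  if (a, b) is (Some m, Some n) then Some (m + n)%N else None.

Definition len (V : finType) (G : sgraph V) (s : seq V) : option nat :=
  if s is x :: s' then foldr oaddn (Some 0%N) (pairmap (dist G) x s') else Some 0%N.

Definition is_gen (V : finType) (G : sgraph V) (l : nat) (s : seq V) : bool :=
  sorted (fun x y => x != y) s && (len G s == Some l).

Definition gen (V : finType) (G : sgraph V) (k l : nat) : finType :=
  {x : k.+1.-tuple V | is_gen G l x}.

Definition MC (V : finType) (G : sgraph V) (k l : nat) : zmodType :=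
  {ffun gen G k l -> int}.

Definition vert (V : finType) (k : nat) (x : k.+1.-tuple V) (j : nat) : V :=
  tnth x (inord j).

Definition smooth (V : finType) (G : sgraph V) (k : nat) (x : k.+1.-tuple V) (i : nat) : bool :=
  dist G (vert x i.-1) (vert x i.+1) ==
  oaddn (dist G (vert x i.-1) (vert x i)) (dist G (vert x i) (vert x i.+1)).

Definition delete (V : finType) (i : nat) (s : seq V) : seq V := take i s ++ drop i.+1 s.

Lemma dist_eq0 (V : finType) (G : sgraph V) (x y : V) : dist G x y = Some 0%N -> x = y.
Proof.
rewrite /dist; case: pselect => // h [] ; case: ex_minnP => m /existsP[s /and3P[_ _ /eqP <-]] _ m0.
by move: s; rewrite m0 => s; rewrite tuple0.
Qed.

Lemma distxx (V : finType) (G : sgraph V) (x : V) : dist G x x = Some 0%N.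
Proof.
have h0 : has_path G x x 0 by apply/existsP; exists [tuple]; rewrite /= eqxx.
rewrite /dist; case: pselect => [h|[]]; last by exists 0%N.
by case: ex_minnP => m _ /(_ _ h0); case: m.
Qed.

Lemma oaddnA (a b c : option nat) : oaddn a (oaddn b c) = oaddn (oaddn a b) c.
Proof. by case: a b c => [m|] [n|] [p|] //=; rewrite /oaddn addnA. Qed.

Lemma oaddn_eq0 (a b : option nat) : oaddn a b = Some 0%N -> a = Some 0%N.
Proof. by case: a b => [m|] [n|] //= [] /eqP; rewrite addn_eq0 => /andP[/eqP ->]. Qed.

Lemma foldr_oaddn_cat (a b : seq (option nat)) :
  foldr oaddn (Some 0%N) (a ++ b) = oaddn (foldr oaddn (Some 0%N) a) (foldr oaddn (Some 0%N) b).
Proof.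
by elim: a => [|u a IH] /=; [case: foldr | rewrite IH oaddnA].
Qed.

Lemma len_cat (V : finType) (G : sgraph V) (s : seq V) (x : V) (t : seq V) :
  len G (rcons s x ++ t) = oaddn (len G (rcons s x)) (len G (x :: t)).
Proof.
case: s => [|y s] /=; first by case: (foldr _ _ _).
by rewrite pairmap_cat foldr_oaddn_cat last_rcons.
Qed.

Lemma is_gen_delete (V : finType) (G : sgraph V) (k l : nat) (x : k.+1.-tuple V) (i : nat) :
  (0 < i < k)%N -> is_gen G l x -> smooth G x i -> is_gen G l (delete i x).
Proof.
case/andP=> i0 ik /andP[sx /eqP Lx] sm.
have sz : size x = k.+1 by rewrite size_tuple.
set x0 := vert x 0.
have nv j : (j <= k)%N -> vert x j = nth x0 x j.
  by move=> jk; rewrite /vert (tnth_nth x0) inordK.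
move: sm; rewrite /smooth !nv; try by [|exact: ltnW|apply: leq_trans (leq_pred _) (ltnW ik)].
- set a := nth _ _ i.-1; set b := nth _ _ i; set c := nth _ _ i.+1 => /eqP sm.
have E : (x : seq V) = rcons (take i.-1 x) a ++ b :: c :: drop i.+2 x.
  rewrite -take_nth ?prednK // ?sz ?ltnS; last by apply: ltnW; apply: leq_trans ik.
  rewrite -!drop_nth ?cat_take_drop // sz ltnS //; exact: ltnW.
have D : delete i x = rcons (take i.-1 x) a ++ c :: drop i.+2 x.
  rewrite /delete -take_nth ?prednK // ?sz ?ltnS; last by apply: ltnW; apply: leq_trans ik.
  by rewrite -drop_nth // sz ltnS.
move: (take i.-1 x) (drop i.+2 x) E D => t u E D.
move: sx Lx; rewrite /is_gen D E !len_cat /=.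
rewrite sm => S L.
have {}sm : a != b -> a != c.
  apply: contraNN => /eqP ac; apply/eqP/(@dist_eq0 _ G).
  by move: sm; rewrite -ac distxx => /esym/oaddn_eq0.
apply/andP; split; last first.
  by rewrite -L !oaddnA.
move: S; case: t {E D L} => [|z s] /=.
  by case/and3P=> /sm -> _ ->.
by rewrite !cat_path !last_rcons /= => /and4P[-> /sm -> _ ->].
Qed.

(* The basis vector of MC_{k,l} at the tuple s; it is 0 if s is not a generator,
   which does not occur in [boundary_gen] by [is_gen_delete]. *)
Definition basis (V : finType) (G : sgraph V) (k l : nat) (s : seq V) : MC G k l :=
  [ffun b : gen G k l => ((val b : seq V) == s)%:R].

(* For k = 0 the sum in [boundary_gen] is empty and the map is zero, so that
   its codomain, here MC_{0,l} instead of MC_{-1,l} = 0, is irrelevant. *)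
Definition boundary_gen (V : finType) (G : sgraph V) (k l : nat) (x : k.+1.-tuple V) :
    MC G k.-1 l :=
  \sum_(1 <= i < k | smooth G x i) basis G k.-1 l (delete i x) *~ ((-1) ^+ i).

Definition boundary (V : finType) (G : sgraph V) (k l : nat) (f : MC G k l) : MC G k.-1 l :=
  \sum_(x : gen G k l) boundary_gen G l (val x) *~ f x.

Lemma boundary_is_zmod_morphism (V : finType) (G : sgraph V) (k l : nat) :
  zmod_morphism (@boundary V G k l).
Proof.
move=> f g; rewrite /boundary -sumrB; apply: eq_bigr => x _.
by rewrite !ffunE mulrzBr.
Qed.

HB.instance Definition _ (V : finType) (G : sgraph V) (k l : nat) :=
  GRing.isZmodMorphism.Build (MC G k l) (MC G k.-1 l) (@boundary V G k l)
    (@boundary_is_zmod_morphism V G k l).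

Definition ker_boundary (V : finType) (G : sgraph V) (k l : nat) : {pred MC G k l} :=
  fun f => boundary f == 0.

Lemma ker_boundary_zmod_closed (V : finType) (G : sgraph V) (k l : nat) :
  zmod_closed (@ker_boundary V G k l).
Proof.
split=> [|f g]; rewrite !unfold_in /=; first by rewrite raddf0.
by move=> /eqP bf /eqP bg; rewrite raddfB /= bf bg subrr.
Qed.

HB.instance Definition _ (V : finType) (G : sgraph V) (k l : nat) :=
  GRing.isZmodClosed.Build (MC G k l) (@ker_boundary V G k l)
    (@ker_boundary_zmod_closed V G k l).

Record cycles (V : finType) (G : sgraph V) (k l : nat) := Cycle {
  chain_of_cycle : MC G k l;
  cycleP : chain_of_cycle \in @ker_boundary V G k l }.

HB.instance Definition _ (V : finType) (G : sgraph V) (k l : nat) :=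
  [isSub for @chain_of_cycle V G k l].
HB.instance Definition _ (V : finType) (G : sgraph V) (k l : nat) :=
  [Choice of cycles G k l by <:].
HB.instance Definition _ (V : finType) (G : sgraph V) (k l : nat) :=
  [SubChoice_isSubZmodule of cycles G k l by <:].

Definition im_boundary (V : finType) (G : sgraph V) (k l : nat) : {pred cycles G k l} :=
  fun z => `[< exists f : MC G k.+1 l, boundary f = val z >].

Lemma im_boundary_zmod_closed (V : finType) (G : sgraph V) (k l : nat) :
  zmod_closed (@im_boundary V G k l).
Proof.
split=> [|z w].
  by apply/asboolP; exists 0; rewrite raddf0.
move=> /asboolP[f bf] /asboolP[g bg]; apply/asboolP; exists (f - g).
by rewrite raddfB /= bf bg.
Qed.

HB.instance Definition _ (V : finType) (G : sgraph V) (k l : nat) :=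
  GRing.isZmodClosed.Build (cycles G k l) (@im_boundary V G k l)
    (@im_boundary_zmod_closed V G k l).

Definition MH (V : finType) (G : sgraph V) (k l : nat) : zmodType :=
  Quotient.quot (@im_boundary V G k l).

Definition Zfree (A : zmodType) (r : nat) (v : 'I_r -> A) : Prop :=
  forall m : 'I_r -> int, \sum_i v i *~ m i = 0 -> forall i, m i = 0.

Definition is_rank (A : zmodType) (r : nat) : Prop :=
  (exists v : 'I_r -> A, Zfree v) /\
  (forall (s : nat) (v : 'I_s -> A), Zfree v -> (s <= r)%N).

(* The maximal number of Z-linearly independent elements; it exists for every
   finitely generated A, and the value 0 is junk otherwise. *)
Definition rk (A : zmodType) : nat := xget 0%N [set r | is_rank A r].

Definition chi (V : finType) (G : sgraph V) (l : nat) : int :=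
  \sum_(0 <= k < l.+1) (-1) ^+ k * (rk (MH G k l))%:Z.

(* G_{n,p} through its law on the finite set of graphs with vertex set 'I_n:
   independence of the edges is the product form of the mass function.  It is a
   probability mass function when 0 <= p <= 1; with p = c / n this excludes
   only the finitely many n < c (and c / 0 = 0), which limits do not see. *)
Definition ER_mass (R : realType) (n : nat) (p : R) (G : sgraph 'I_n) : R :=
  \prod_(e in vpairs 'I_n) (if e \in edges G then p else 1 - p).

Definition ER_expectation (R : realType) (n : nat) (p : R) (X : sgraph 'I_n -> R) : R :=
  \sum_(G : sgraph 'I_n) ER_mass p G * X G.

Definition ER_probability (R : realType) (n : nat) (p : R) (A : pred (sgraph 'I_n)) : R :=
  \sum_(G : sgraph 'I_n | A G) ER_mass p G.

(* Main.v *)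
Require Import Defs.
From HB Require Import structures.
From mathcomp Require Import all_boot all_order all_algebra ring_quotient.
From mathcomp Require Import all_classical all_reals all_analysis.
From mathcomp Require Import ring lra zify.
Import Order.TTheory GRing.Theory Num.Theory.
Import numFieldNormedType.Exports.
Local Open Scope classical_set_scope.
Local Open Scope ring_scope.

Set Implicit Arguments.
Unset Strict Implicit.
Unset Printing Implicit Defensive.

(**
By the Euler-Poincare principle, chi_l is the alternating sum of the numbers of
generators of MC_{k,l}, hence the sum over the vertices x of weights W_l(x)
determined by W_0 = 1 and
  W_l(x) = - \sum_(1 <= j <= l) \sum_(d(x,y) = j) W_{l-j}(y).
When G has no cycle near x the solution is W_l(x) = (-1)^l deg(x): the recursion
telescopes because then the degrees of the vertices at distance j from x sum to
the number of vertices at distance j plus the number at distance j + 1.  In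
general the error is at most a constant times the number of walks of length at
most 2 l from x which traverse at least as many edges as they visit vertices.
For p = c / n the expected total number of such walks is bounded in n, so chi_l
is within O(1) in mean of (-1)^l times the degree sum, whose mean is (n - 1) c
and whose variance is O(n).
*)

(** * Distances *)

Section Distance.
Variables (V : finType) (G : sgraph V).
Local Notation adj := (adj G).
Local Notation dist := (dist G).

Lemma adjC x y : adj x y = adj y x.
Proof. by rewrite /Defs.adj finset.setUC. Qed.

Lemma adj_neq x y : adj x y -> x != y.
Proof.
move=> a; apply/eqP => E; move: (fintype.subsetP (edgesP G) _ a).
by rewrite inE E finset.setUid cards1.
Qed.

(** Distances are defined by simple paths; cutting the loops out of a walk gives a simple path that
    is no longer, so walks can be concatenated freely. *)
Lemma dist_leq x s : path adj x s -> exists2 k, (k <= size s)%N & dist x (last x s) = Some k.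
Proof.
move=> ps; case: (shortenP ps) => s' ps' us' /(uniq_leq_size (andP us').2) ss'.
have h : has_path G x (last x s') (size s').
  by apply/existsP; exists (in_tuple s'); apply/and3P; split.
rewrite /Defs.dist; case: pselect => [H|[]]; last by exists (size s').
case: ex_minnP => m _ /(_ _ h) hm; exists m => //.
exact: leq_trans ss'.
Qed.

Lemma dist_walk x y k : dist x y = Some k ->
  exists s, [/\ path adj x s, size s = k & last x s = y].
Proof.
rewrite /Defs.dist; case: pselect => // H []; case: ex_minnP => m /existsP[s /and3P[ps _ /eqP ls]] _ <-.
by exists s; rewrite size_tuple.
Qed.

Lemma dist_triangle x y z a b : dist x y = Some a -> dist y z = Some b ->
  exists2 c, (c <= a + b)%N & dist x z = Some c.
Proof.
move=> /dist_walk[s [ps <- <-]] /dist_walk[t [pt <- <-]].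
by have := @dist_leq x (s ++ t); rewrite cat_path ps pt size_cat last_cat; exact.
Qed.

Lemma dist_sym x y : dist x y = dist y x.
Proof.
suff H u v k : dist u v = Some k -> exists2 m, (m <= k)%N & dist v u = Some m.
  case E: (dist x y) => [k|]; last first.
    case E': (dist y x) => [m|] //; have [k _] := H _ _ _ E'; by rewrite E.
  have [m mk E'] := H _ _ _ E; have [k' km] := H _ _ _ E'; rewrite E => -[Ek].
  rewrite -{}Ek in km; by rewrite E'; congr Some; apply/eqP; rewrite eqn_leq mk km.
move=> /dist_walk[s [ps <- <-]].
have := @dist_leq (last u s) (rev (belast u s)).
have -> : last (last u s) (rev (belast u s)) = u.
  by case: s {ps} => //= z s; rewrite rev_cons last_rcons.
rewrite size_rev size_belast; apply; rewrite rev_path.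
by apply: sub_path ps => w z /=; rewrite adjC.
Qed.

Lemma dist_adj x y : adj x y -> dist x y = Some 1%N.
Proof.
move=> a; have [|k] := @dist_leq x [:: y]; first by rewrite /= a.
case: k => [|[]] //= _ /dist_eq0 E; by move: (adj_neq a); rewrite E eqxx.
Qed.

Lemma dist_first x y j : dist x y = Some j.+1 -> exists2 z, adj x z & dist z y = Some j.
Proof.
move=> E; case: (dist_walk E) => -[|z s] [] //= /andP[xz ps] [sz] ls.
exists z => //; have [k ks] := dist_leq ps; rewrite ls => E'.
have [c + Ec] := dist_triangle (dist_adj xz) E'; move: Ec.
rewrite E => -[<-]; rewrite add1n ltnS => jk; rewrite E'; congr Some; apply/eqP.
by rewrite eqn_leq jk -sz ks.
Qed.

End Distance.

(** * The boundary map squares to zero *)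

(** The cancellation behind every simplicial boundary: the terms below the diagonal, shifted by one
    row, cancel those on and above it. *)
Lemma simplicial_sum_eq0 (A : zmodType) (F : nat -> nat -> A) m :
    (forall i j, (j <= i)%N -> F i.+1 j = - F j i) ->
  \sum_(1 <= i < m.+1) \sum_(1 <= j < m) F i j = 0.
Proof.
move=> HF; case: m => [|m]; first by rewrite big_geq.
have cmp i : \sum_(1 <= j < m.+1) F i j =
    \sum_(1 <= j < m.+1) (if (j < i)%N then F i j else 0) +
    \sum_(1 <= j < m.+1) (if (i <= j)%N then F i j else 0).
  rewrite -big_split /=; apply: eq_bigr => j _.
  by rewrite (leqNgt i j); case: (j < i)%N; rewrite ?addr0 ?add0r.
under eq_bigr => i _ do rewrite cmp.
(* The last row has no entry with [i <= j] and the row [i = 1] none with [j < i]; dropping both and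
   shifting [i] gives two sums over the same range. *)
rewrite big_split /= [X in _ + X]big_nat_recr //= [X in _ + (_ + X)]big1_seq ?addr0; last first.
  by move=> j; rewrite mem_index_iota => /andP[_ /andP[_ jm]]; rewrite leqNgt jm.
rewrite big_add1 /= [X in X + _]big_ltn // [X in X + _ + _]big1_seq ?add0r; last first.
  by move=> j; rewrite mem_index_iota => /andP[_ /andP[j0 _]]; rewrite ltnNge j0.
rewrite exchange_big -big_split big1 //= => j _; rewrite -big_split big1 //= => i _.
by rewrite ltnS; case: ifP => [ji|_]; rewrite ?addr0 // HF // addNr.
Qed.

Section Boundary.
Variables (V : finType) (G : sgraph V) (l : nat).
Local Notation dist := (dist G).
Local Notation len := (len G).

Lemma len_cons2 x y s : len [:: x, y & s] = oaddn (dist x y) (len (y :: s)).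
Proof. by []. Qed.

(** The triangle inequality handles an inner vertex; deleting an end vertex only loses a step. *)
Lemma len_delete i s n : len s = Some n ->
  exists2 m, (m <= n)%N & len (delete i s) = Some m.
Proof.
elim: s i n => [|x s IH] i n; first by move=> -[<-]; exists 0%N.
case: s IH => [|y s] IH.
  by move=> _; exists 0%N => //; rewrite /delete; case: i => [|[]].
rewrite len_cons2; case Exy: (dist x y) => [a|] //.
case Es: (len (y :: s)) => [b|] // -[<-].
case: i => [|[|i]].
- by exists b; [rewrite leq_addl | rewrite /delete /= ?drop0].
- have -> : delete 1 [:: x, y & s] = x :: s by rewrite /delete /= drop0.
  case: s IH Es => [|z s] IH; first by exists 0%N.
  rewrite !len_cons2; case Eyz: (dist y z) => [c|] //.
  case: (len (z :: s)) => [d|] // -[<-].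
  have [e le Exz] := dist_triangle Exy Eyz.
  by exists (e + d)%N; [rewrite addnA leq_add2r | rewrite Exz].
- have [m mb Em] := IH i.+1 _ Es.
  exists (a + m)%N; first by rewrite leq_add2l.
  have -> : delete i.+2 [:: x, y & s] = [:: x, y & delete i s] by [].
  by rewrite len_cons2 Exy Em.
Qed.

(* The class of tuples on which the unrestricted alternating sum of deletions
   computes the boundary: both sides of [boundary_basis] vanish on short tuples. *)
Definition gen_or_shorter (s : seq V) :=
  is_gen G l s \/ exists2 n, (n < l)%N & len s = Some n.

(** If the length did not drop, cancelling the common finite terms would leave
    $d(a,c)=d(a,b)+d(b,c)$, which is smoothness. *)
Lemma len_delete_nonsmooth k (x : k.+1.-tuple V) i : (0 < i < k)%N ->
  is_gen G l x -> ~~ smooth G x i -> exists2 n, (n < l)%N & len (delete i x) = Some n.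
Proof.
move=> ik gx sm.
case/andP: ik => i0 ik; have /andP[_ /eqP Lx] := gx.
have [n nl Ln] := len_delete i Lx; exists n => //.
rewrite ltn_neqAle nl andbT; apply: contraNneq sm => En; move: Ln; rewrite {}En => {nl n}.
have sz : size x = k.+1 by rewrite size_tuple.
set x0 := vert x 0.
have nv j : (j <= k)%N -> vert x j = nth x0 x j.
  by move=> jk; rewrite /vert (tnth_nth x0) inordK.
rewrite /smooth !nv; try by [|exact: ltnW|apply: leq_trans (leq_pred _) (ltnW ik)].
set a := nth _ _ i.-1; set b := nth _ _ i; set c := nth _ _ i.+1.
have E : (x : seq V) = rcons (take i.-1 x) a ++ b :: c :: drop i.+2 x.
  rewrite -take_nth ?prednK // ?sz ?ltnS; last by apply: ltnW; apply: leq_trans ik.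
  rewrite -!drop_nth ?cat_take_drop // sz ltnS //; exact: ltnW.
have D : delete i x = rcons (take i.-1 x) a ++ c :: drop i.+2 x.
  rewrite /delete -take_nth ?prednK // ?sz ?ltnS; last by apply: ltnW; apply: leq_trans ik.
  by rewrite -drop_nth // sz ltnS.
move: (take i.-1 x) (drop i.+2 x) E D => t u E D.
move: Lx; rewrite D E !len_cat !len_cons2.
case: (len (rcons t a)) => [p|] //; case: (dist a b) => [q|] //.
case: (dist b c) => [r|] //; case: (len (c :: u)) => [v|] //.
case: (dist a c) => [w|] // [<-] [].
by rewrite !addnA => /addIn; rewrite -!addnA => /addnI ->.
Qed.

Lemma basis_eq0 k s : ~~ is_gen G l s -> Defs.basis G k l s = 0.
Proof.
move=> ns; apply/ffunP => b; rewrite !ffunE; case: eqP => // Eb.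
by move: ns; rewrite -Eb (valP b).
Qed.

(* Deleting a non-smooth vertex shortens the tuple, so that [basis] returns 0. *)
Lemma boundary_genE k (x : k.+1.-tuple V) : is_gen G l x ->
  boundary_gen G l x = \sum_(1 <= i < k) Defs.basis G k.-1 l (delete i x) *~ ((-1) ^+ i).
Proof.
move=> gx; rewrite /boundary_gen big_mkcond; apply: eq_big_nat => i ik.
case: ifPn => // /(len_delete_nonsmooth ik gx)[n nl Ln].
rewrite basis_eq0 ?mul0rz //; apply/negP => /andP[_]; rewrite Ln => /eqP[En].
by rewrite En ltnn in nl.
Qed.

Lemma boundary_basis k (s : seq V) : size s = k.+1 -> gen_or_shorter s ->
  boundary (Defs.basis G k l s) = \sum_(1 <= i < k) Defs.basis G k.-1 l (delete i s) *~ ((-1) ^+ i).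
Proof.
move=> sz [gs|[n nl Ln]]; last first.
  have nonshort t m : len t = Some m -> (m < l)%N -> ~~ is_gen G l t.
    by move=> Lt ml; apply/negP => /andP[_]; rewrite Lt => /eqP[E]; rewrite E ltnn in ml.
  rewrite basis_eq0; last exact: nonshort nl.
  rewrite raddf0 big1 // => i _; rewrite basis_eq0 ?mul0rz //.
  have [m mn Lm] := len_delete i Ln; apply: (nonshort _ _ Lm); exact: leq_ltn_trans nl.
have szb : size s == k.+1 by rewrite sz.
pose x : gen G k l := exist _ (Tuple szb) gs.
rewrite /boundary (bigD1 x) //= big1 ?addr0; last first.
  move=> y yx; rewrite ffunE; case: eqP => [E|]; last by rewrite mulr0z.
  by case/eqP: yx; apply/val_inj/val_inj.
by rewrite ffunE eqxx mulr1z boundary_genE.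
Qed.

Lemma delete_delete i j (s : seq V) : (j <= i)%N ->
  delete j (delete i.+1 s) = delete i (delete j s).
Proof.
rewrite /delete; elim: i j s => [|i IH] [|j] [|x s] //= ji; rewrite ?drop0 //=.
by rewrite IH.
Qed.

Lemma boundaryK k (f : MC G k.+1 l) : boundary (boundary f) = 0.
Proof.
rewrite [boundary f]/boundary raddf_sum big1 // => x _; rewrite raddfMz /=.
suff -> : boundary (boundary_gen G l (val x)) = 0 by rewrite mul0rz.
have sx : size (val x) = k.+2 by rewrite size_tuple.
have gx := valP x; rewrite boundary_genE // raddf_sum /=.
rewrite (eq_big_nat _ _ (F2 := fun i => \sum_(1 <= j < k)
    Defs.basis G k.-1 l (delete j (delete i (val x))) *~ ((-1) ^+ (i + j)))); last first.
  move=> i ik; rewrite raddfMz /= boundary_basis; last first.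
  (* Both alternatives of [gen_or_shorter] occur, according to whether the first deleted vertex is
     smooth. *)
  - case: (boolP (smooth G (val x) i)) => sm; first by left; apply: is_gen_delete.
    by right; apply: len_delete_nonsmooth.
  - move/andP: ik => [i0 ik]; rewrite /delete size_cat size_take size_drop sx ltnS ltnW //.
    by rewrite subSS addnBA ?addKn // ltnW.
  by rewrite mulrz_suml; apply: eq_bigr => j _; rewrite exprD mulrC -mulrzA.
case: k x sx f {gx} => [|k] x sx f; first by rewrite big_geq.
apply: simplicial_sum_eq0 => i j ji.
by rewrite delete_delete // addSn exprS mulN1r mulrNz addnC.
Qed.
End Boundary.

(** * Ranks *)

Lemma rk_unique (A : zmodType) r : is_rank A r -> rk A = r.
Proof.
move=> Ar; have [[v fv] ub] := Ar.
rewrite /rk; case: xgetP => [s -> [[w fw] ub']|/(_ r)//].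
by apply/eqP; rewrite eqn_leq (ub _ _ fw) (ub' _ _ fv).
Qed.

(** * Integral chains as rational row vectors *)

Section RationalMatrix.

Definition rowQ (I : finType) (u : {ffun I -> int}) : 'rV[rat]_#|I| :=
  \row_i (u (enum_val i))%:~R.

Definition mxQ (I J : finType) (f : {ffun I -> int} -> {ffun J -> int}) :
    'M[rat]_(#|I|, #|J|) :=
  \matrix_i rowQ (f [ffun x => (x == enum_val i)%:R]).

Lemma rowQ_inj (I : finType) : injective (@rowQ I).
Proof.
move=> u v /rowP E; apply/ffunP => x.
by have := E (enum_rank x); rewrite !mxE enum_rankK => /intr_inj.
Qed.

Lemma rowQ_is_zmod_morphism (I : finType) : zmod_morphism (@rowQ I).
Proof. by move=> u v; apply/rowP => i; rewrite !mxE !ffunE rmorphB. Qed.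

HB.instance Definition _ (I : finType) :=
  GRing.isZmodMorphism.Build {ffun I -> int} 'rV[rat]_#|I| (@rowQ I)
    (@rowQ_is_zmod_morphism I).

Lemma rowQ_sum (I : finType) s (u : 'I_s -> {ffun I -> int}) (m : 'I_s -> int) :
  rowQ (\sum_i u i *~ m i) = (\row_i (m i)%:~R) *m \matrix_i rowQ (u i).
Proof.
rewrite raddf_sum mulmx_sum_row; apply: eq_bigr => i _.
by rewrite rowK mxE raddfMz /= scaler_int.
Qed.

Lemma rowQ_mul (I J : finType) (f : {additive {ffun I -> int} -> {ffun J -> int}}) u :
  rowQ (f u) = rowQ u *m mxQ f.
Proof.
have {1}-> : u = \sum_(i < #|I|) [ffun x => (x == enum_val i)%:R] *~ u (enum_val i).
  apply/ffunP => x; rewrite sum_ffunE (bigD1 (enum_rank x)) //= big1 ?addr0.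
    by rewrite enum_rankK ffunMzE ffunE eqxx intz.
  move=> i ix; rewrite ffunMzE ffunE; have [E|_] := eqVneq x (enum_val i); last by rewrite mul0rz.
  by rewrite E enum_valK eqxx in ix.
rewrite raddf_sum /=; under eq_bigr => i _ do rewrite raddfMz.
by rewrite rowQ_sum.
Qed.

Lemma clear_denominators n (v : 'rV[rat]_n) :
  exists2 d : int, d != 0 & exists m : 'I_n -> int, forall i, (m i)%:~R = d%:~R * v 0 i.
Proof.
exists (\prod_i denq (v 0 i)); first by apply/prodf_neq0 => i _; rewrite denq_eq0.
exists (fun i => numq (v 0 i) * \prod_(j | j != i) denq (v 0 j)) => i.
by rewrite [in RHS](bigD1 i) //= !intrM numqE [in RHS]mulrAC [X in X * _]mulrC.
Qed.

Lemma clear_denominators_rowQ (I : finType) (v : 'rV[rat]_#|I|) :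
  exists2 d : int, d != 0 & exists u, rowQ u = d%:~R *: v.
Proof.
have [d d0 [m Em]] := clear_denominators v; exists d => //.
exists [ffun x => m (enum_rank x)].
by apply/rowP => i; rewrite !mxE ffunE enum_valK Em.
Qed.

End RationalMatrix.

(** * Homology ranks and the Euler-Poincare formula *)

Section Rank.
Variables (V : finType) (G : sgraph V).

Local Open Scope quotient_scope.

Lemma rowQ_boundary k l (u : MC G k l) :
  rowQ (boundary u) = rowQ u *m mxQ (@boundary V G k l).
Proof. by rewrite -rowQ_mul. Qed.

Lemma MH_eq0 k l (z : cycles G k l) :
  \pi_(MH G k l) z = 0 <-> exists w : MC G k.+1 l, boundary w = val z.
Proof.
have := Quotient.idealrBE (@im_boundary V G k l) z 0.
rewrite subr0 raddf0 => E.
split=> [z0|H]; first by apply/asboolP; move: E; rewrite z0 eqxx.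
by apply/eqP; rewrite -E; apply/asboolP.
Qed.

Lemma MH_sum_eq0 k l s (z : 'I_s -> cycles G k l) (m : 'I_s -> int) :
  \sum_i \pi_(MH G k l) (z i) *~ m i = 0 <->
  exists w : MC G k.+1 l, boundary w = \sum_i val (z i) *~ m i.
Proof.
have -> : \sum_i \pi_(MH G k l) (z i) *~ m i = \pi_(MH G k l) (\sum_i z i *~ m i).
  by rewrite raddf_sum; apply: eq_bigr => i _; rewrite raddfMz.
rewrite MH_eq0 raddf_sum /=.
have -> : \sum_i val (z i *~ m i) = \sum_i val (z i) *~ m i.
  by apply: eq_bigr => i _; rewrite raddfMz.
by [].
Qed.

Section Degree.
Variables k l : nat.
Local Notation A := (mxQ (@boundary V G k l)).
Local Notation B := (mxQ (@boundary V G k.+1 l)).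

Lemma boundary_kermx (u : MC G k l) : (boundary u == 0) = (rowQ u <= kermx A)%MS.
Proof.
apply/eqP/sub_kermxP; first by rewrite -rowQ_boundary => ->; rewrite raddf0.
by rewrite -rowQ_boundary => E; apply: rowQ_inj; rewrite E raddf0.
Qed.

Lemma im_sub_ker : (B <= kermx A)%MS.
Proof. by apply/row_subP => i; rewrite rowK -boundary_kermx boundaryK. Qed.

(** Over the rationals the homology is the kernel of [A] modulo the row space of [B], and
    [kermx A :\: B] is a complement of the latter in the former. Clearing denominators passes
    between rational and integral independence. *)
Lemma MH_is_rank : is_rank (MH G k l) (\rank (kermx A :\: B)%MS).
Proof.
split.
  pose C := row_base (kermx A :\: B)%MS.
  have CA : (C <= kermx A)%MS by rewrite eq_row_base diffmxSl.
  have /choice[du Edu] : forall i, exists du : int * MC G k l,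
      du.1 != 0 /\ rowQ du.2 = du.1%:~R *: row i C.
    by move=> i; have [d d0 [u Eu]] := clear_denominators_rowQ (row i C); exists (d, u).
  have cyc i : (du i).2 \in @ker_boundary V G k l.
    rewrite unfold_in boundary_kermx (Edu i).2 scalemx_sub //.
    exact: submx_trans (row_sub _ _) CA.
  (* An integral relation puts [q *m C] both in the row space of [B] and in its complement, so it is
     zero; the rows of [C] are free, hence [q] is zero. *)
  exists (fun i => \pi_(MH G k l) (Cycle (cyc i))) => m /MH_sum_eq0[w /=] /(congr1 (@rowQ _)).
  rewrite (rowQ_boundary (k := k.+1)) rowQ_sum => E.
  pose q := \row_i ((m i)%:~R * (du i).1%:~R : rat).
  have Eq : rowQ w *m B = q *m C.
    rewrite [LHS]E !mulmx_sum_row; apply: eq_bigr => i _.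
    by rewrite rowK (Edu i).2 !mxE scalerA.
  have q0 : q *m C = 0 *m C.
    rewrite mul0mx; apply/eqP; rewrite -submx0 -(capmx_diff (kermx A) B) sub_capmx.
    by rewrite -{2}Eq submxMl (submx_trans (submxMl _ _)) // eq_row_base.
  move=> i; have /rowP/(_ i) := row_free_inj (row_base_free _) q0.
  rewrite !mxE => /eqP; rewrite mulf_eq0 !intr_eq0 (negPf (Edu i).1) orbF.
  by move/eqP.
move=> s v fv; pose z i := repr (v i).
have Ez : v = fun i => \pi_(MH G k l) (z i) by apply/funext => i; rewrite reprK.
pose U := \matrix_i rowQ (val (z i)).
(* Multiplying by the denominators [d] of [q] and [e] of [w] turns the rational relation into an
   integral one in homology, where [v] is free. *)
have UB (q : 'rV_s) : (q *m U <= B)%MS -> q = 0.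
  case/submxP => w Ew; have [d d0 [m Em]] := clear_denominators q.
  have [e e0 [W EW]] := clear_denominators_rowQ w.
  have /fv m0 : \sum_i v i *~ (m i * e) = 0.
    rewrite Ez; apply/MH_sum_eq0; exists (W *~ d); apply: rowQ_inj.
    rewrite (rowQ_boundary (k := k.+1)) rowQ_sum raddfMz /= EW -scaler_int -!scalemxAl -Ew.
    have -> : \row_i (m i * e)%:~R = (d%:~R * e%:~R) *: q :> 'rV[rat]_s.
      by apply/rowP => i; rewrite !mxE intrM Em mulrAC.
    by rewrite -scalemxAl scalerA.
  apply/rowP => i; rewrite mxE; apply/eqP; have := Em i.
  move/eqP: (m0 i); rewrite mulf_eq0 (negPf e0) orbF => /eqP -> /esym/eqP.
  by rewrite mulf_eq0 intr_eq0 (negPf d0).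
have fU : row_free U by apply: inj_row_free => q E; apply: UB; rewrite E sub0mx.
have UB0 : (U :&: B)%MS = 0.
  apply/eqP/rowV0P => q; rewrite sub_capmx => /andP[/submxP[p ->] /UB ->].
  by rewrite mul0mx.
have UK : (U <= kermx A)%MS.
  apply/row_subP => i; rewrite rowK -boundary_kermx.
  exact: (cycleP (z i)).
(* The row space of [U] has dimension [s], lies in the kernel and meets that of [B] trivially, so
   [s] is at most the codimension of [B] in the kernel. *)
have := mxrank_sum_cap U B; rewrite UB0 mxrank0 addn0 (eqP fU) => Er.
have : (\rank (U + B)%MS <= \rank (kermx A))%N.
  by apply: mxrankS; rewrite addsmx_sub UK im_sub_ker.
rewrite Er -(mxrank_cap_compl (kermx A) B) addnC.
by rewrite (capmx_idPr im_sub_ker) leq_add2l.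
Qed.

Lemma rk_MH : (rk (MH G k l) + \rank A + \rank B)%N = #|gen G k l|.
Proof.
rewrite (rk_unique MH_is_rank).
have := mxrank_cap_compl (kermx A) B.
rewrite (capmx_idPr im_sub_ker) mxrank_ker addnC addnAC => ->.
by rewrite subnK // rank_leq_row.
Qed.

End Degree.

(** Consecutive vertices differ, so every step has length at least 1. *)
Lemma is_gen_size l v s : is_gen G l (v :: s) -> (size s <= l)%N.
Proof.
elim: s v l => [|w s IH] v l // /andP[/= /andP[vw sw]].
rewrite -/(len G (w :: s)) => /eqP.
case Ed: (dist G v w) => [[|d]|] //; first by rewrite (dist_eq0 Ed) eqxx in vw.
case El: (len G (w :: s)) => [m|] // [<-].
have sm : (size s <= m)%N by apply: (IH w); apply/andP; split; [exact: sw | apply/eqP].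
by rewrite addSn ltnS (leq_trans sm) // leq_addl.
Qed.

Lemma gen_leq k l : (0 < #|gen G k l|)%N -> (k <= l)%N.
Proof.
case/card_gt0P => x _; have := valP x.
case: (tupleP (val x)) => v s /is_gen_size; by rewrite size_tuple.
Qed.

(** Each boundary rank enters in two consecutive degrees with opposite signs. The ends vanish: the
    boundary in degree 0 is zero, and degree [l.+1] has no generators. *)
Lemma chiE l : chi G l = \sum_(0 <= k < l.+1) (-1) ^+ k * (#|gen G k l|%:Z).
Proof.
pose r k : int := (\rank (mxQ (@boundary V G k l)))%:Z.
have r0 : r 0%N = 0.
  rewrite /r (_ : mxQ _ = 0) ?mxrank0 //; apply/row_matrixP => i.
  rewrite rowK row0 (_ : boundary _ = 0) ?raddf0 // /boundary big1 // => x _.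
  by rewrite /boundary_gen big_geq // mul0rz.
have rl : r l.+1 = 0.
  have := rank_leq_row (mxQ (@boundary V G l.+1 l)).
  case: (posnP #|gen G l.+1 l|) => [E|/gen_leq]; last by rewrite ltnn.
  by rewrite [X in (_ <= X)%N -> _]E leqn0 /r => /eqP ->.
rewrite /chi; under [RHS]eq_bigr => k _ do rewrite -rk_MH !PoszD -!/(r _) !mulrDr.
rewrite !big_split /= -addrA -[LHS]addr0; congr (_ + _).
rewrite big_nat_recl //= r0 mulr0 add0r [X in _ + X]big_nat_recr //= rl mulr0 addr0.
rewrite -big_split big1 //= => k _.
by rewrite exprS mulN1r mulNr addNr.
Qed.

End Rank.

(** * Vertex weights *)

Lemma big_tupleS (A : nmodType) (T : finType) k (F : k.+1.-tuple T -> A) :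
  \sum_(s : k.+1.-tuple T) F s = \sum_(x : T) \sum_(s : k.-tuple T) F [tuple of x :: s].
Proof.
rewrite pair_big /= (reindex (fun p : T * k.-tuple T => [tuple of p.1 :: p.2])) //=.
exists (fun s => (thead s, [tuple of behead s])) => [[x s] _|s _] /=.
  by rewrite theadE; congr pair; apply/val_inj.
by rewrite -tuple_eta.
Qed.

Section Weights.
Variables (V : finType) (G : sgraph V).
Local Notation adj := (adj G).
Local Notation dist := (dist G).

Fixpoint ngen (k l : nat) (x : V) : nat :=
  if k is k'.+1 then
    (\sum_(1 <= j < l.+1) \sum_(y | dist x y == Some j) ngen k' (l - j) y)%N
  else (l == 0)%N.

(** Only [j] equal to the distance can contribute; distance 0 means [x = y], which both sides
    exclude. *)
Lemma is_gen_cons2 l x y s : (is_gen G l [:: x, y & s] : nat) =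
  (\sum_(1 <= j < l.+1) (dist x y == Some j) * is_gen G (l - j) (y :: s))%N.
Proof.
rewrite /is_gen len_cons2 [sorted _ _]/=.
case Ed: (dist x y) => [d|]; last by rewrite /= andbF big1.
case: d Ed => [|d] Ed.
  rewrite (dist_eq0 Ed) eqxx /= big1_seq // => j; rewrite mem_index_iota => /andP[_ /andP[j0 _]].
  by rewrite [Some 0%N == _](_ : _ = false) //; case: j j0.
have -> : x != y by apply/eqP => xy; move: Ed; rewrite xy distxx.
case Es: (len G (y :: s)) => [m|]; last first.
  by rewrite /= andbF big1 // => j _; rewrite muln0.
rewrite /=; have [dl|ld] := ltnP d l; last first.
  rewrite big1_seq => [|j]; last first.
    rewrite mem_index_iota => /andP[_ /andP[_ jl]]; case: eqP => // -[E].
    by move: jl; rewrite -E ltnS ltnNge ld.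
  case: eqP => [[E]|]; last by rewrite andbF.
  by move: (leq_trans (leq_addr m d.+1) (eq_leq E)); rewrite ltnNge ld.
rewrite (bigD1_seq d.+1) ?mem_index_iota ?iota_uniq //= eqxx mul1n big1 ?addn0.
  congr (nat_of_bool (_ && _)); apply/eqP/eqP => -[E]; congr Some.
    by rewrite -E addKn.
  by rewrite E subnKC.
by move=> j jd; case: eqP => // -[E]; rewrite E eqxx in jd.
Qed.

Lemma card_ngen k l x : (\sum_(s : k.-tuple V) is_gen G l (x :: s))%N = ngen k l x.
Proof.
elim: k l x => [|k IH] l x /=.
  rewrite (big_pred1 [tuple]) => [|s]; last by apply/esym/eqP/val_inj; rewrite tuple0.
  by rewrite /is_gen /= eq_sym; case: l.
rewrite big_tupleS.
transitivity (\sum_y \sum_(1 <= j < l.+1) \sum_(s : k.-tuple V)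
    (dist x y == Some j) * is_gen G (l - j) (y :: s))%N.
  apply: eq_bigr => y _; rewrite exchange_big /=; apply: eq_bigr => s _.
  exact: is_gen_cons2.
rewrite exchange_big /=; apply: eq_bigr => j _; rewrite [RHS]big_mkcond /=.
apply: eq_bigr => y _; case: eqP => _; last by rewrite big1.
by under eq_bigr => s _ do rewrite mul1n; exact: IH.
Qed.

Lemma card_gen k l : #|gen G k l| = (\sum_x ngen k l x)%N.
Proof.
rewrite card_sig -sum1_card big_mkcond /=.
transitivity (\sum_(s : k.+1.-tuple V) is_gen G l s)%N; last first.
  by rewrite big_tupleS; apply: eq_bigr => x _; rewrite -card_ngen.
by apply: eq_bigr => s _; rewrite inE; case: is_gen.
Qed.

Lemma ngen_eq0 k l x : (l < k)%N -> ngen k l x = 0%N.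
Proof.
elim: k l x => // k IH l x lk /=; rewrite big1_seq // => j; rewrite mem_index_iota.
move=> /andP[_ /andP[j0 jl]]; rewrite big1 // => y _; apply: IH.
by rewrite ltn_subLR // (leq_ltn_trans (ltnSE lk)) // -addn1 addnC leq_add2r.
Qed.

Definition weight (l : nat) (x : V) : int :=
  \sum_(0 <= k < l.+1) (-1) ^+ k * (ngen k l x)%:Z.

Lemma chi_weight l : chi G l = \sum_x weight l x.
Proof.
rewrite chiE exchange_big /=; apply: eq_bigr => k _.
by rewrite card_gen -mulr_sumr -(big_morph _ PoszD (erefl _)).
Qed.

(** Puts weights of different lengths on a common range of [k], so that sums can be exchanged. *)
Lemma weight_widen m l x : (l <= m)%N ->
  weight l x = \sum_(0 <= k < m.+1) (-1) ^+ k * (ngen k l x)%:Z.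
Proof.
move=> lm; rewrite (big_cat_nat (n := l.+1)) //= [X in _ + X]big1_seq ?addr0 //.
move=> k; rewrite mem_index_iota => /andP[_ /andP[lk _]].
by rewrite ngen_eq0 // mulr0.
Qed.

Lemma weight0 x : weight 0 x = 1.
Proof. by rewrite /weight big_nat1. Qed.

(** Removing the first vertex lowers [k] by one, whence the sign; [k = 0] contributes nothing at
    positive length. *)
Lemma weightS l x : weight l.+1 x =
  - \sum_(1 <= j < l.+2) \sum_(y | dist x y == Some j) weight (l.+1 - j) y.
Proof.
rewrite {1}/weight big_nat_recl //= mulr0 add0r.
rewrite [X in _ = - X](eq_big_nat _ _ (F2 := fun j => \sum_(0 <= k < l.+1)
   \sum_(y | dist x y == Some j) (-1) ^+ k * (ngen k (l.+1 - j) y)%:Z)); last first.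
  move=> [|j] // /andP[_ jl]; rewrite [RHS]exchange_big /=; apply: eq_bigr => y _.
  by apply: weight_widen; rewrite subSS leq_subr.
rewrite exchange_big -sumrN; apply: eq_bigr => k _.
rewrite exprS mulN1r mulNr; congr (- _).
rewrite (big_morph _ PoszD (erefl _)) mulr_sumr; apply: eq_bigr => j _.
by rewrite (big_morph _ PoszD (erefl _)) mulr_sumr.
Qed.

End Weights.

(** * Walks containing a cycle *)

Section BadWalks.
Variable V : finType.
Implicit Types (x y z : V) (s t : seq V).

Fixpoint walk_edges s : {set {set V}} :=
  if s is x :: s' then
    if s' is y :: _ then ([set x; y] |: walk_edges s')%SET else finset.set0
  else finset.set0.

(* A connected graph with at least as many edges as vertices contains a cycle. *)
Definition bad s := (#|[set x in s]%SET| <= #|walk_edges s|)%N.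

Fixpoint nonbacktracking s : bool :=
  if s is x :: s' then (if s' is _ :: z :: _ then x != z else true) && nonbacktracking s'
  else true.

Lemma walk_edges_vertex s e x : e \in walk_edges s -> x \in e -> x \in s.
Proof.
elim: s => [|y [|z s] IH] /=; rewrite ?inE // => /orP[/eqP->|es xe].
  by rewrite !inE => /orP[]->; rewrite ?orbT.
by move: (IH es xe); rewrite inE => ->; rewrite orbT.
Qed.

Lemma card_vertices_cons x s :
  #|[set y in x :: s]%SET| = ((x \notin s) + #|[set y in s]%SET|)%N.
Proof. by rewrite set_cons cardsU1 inE. Qed.

Lemma card_walk_edges_cons x y s : x \notin y :: s ->
  #|walk_edges [:: x, y & s]| = #|walk_edges (y :: s)|.+1.
Proof.
move=> xs; have xys : [set x; y]%SET \notin walk_edges (y :: s).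
  by apply: contraNN xs => /walk_edges_vertex; apply; rewrite !inE eqxx.
by rewrite [walk_edges _]/= cardsU1 xys.
Qed.

(** A new first vertex brings a new edge; an old one does not raise the vertex count. *)
Lemma bad_cons x y s : bad (y :: s) -> bad [:: x, y & s].
Proof.
rewrite /bad (card_vertices_cons x).
case: (boolP (x \in y :: s)) => [xs|xs] /= bs.
  by rewrite add0n (leq_trans bs) // subset_leq_card // finset.subsetUr.
have := card_walk_edges_cons xs; rewrite /= => ->.
by rewrite add1n ltnS.
Qed.

Lemma card_vertices_leq x s : (#|[set y in x :: s]%SET| <= #|walk_edges (x :: s)|.+1)%N.
Proof.
elim: s x => [|y s IH] x.
  by rewrite cardsE (leq_trans (card_size _)).
rewrite card_vertices_cons; case: (boolP (x \in y :: s)) => xs.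
  by rewrite add0n (leq_trans (IH y)) // ltnS subset_leq_card // finset.subsetUr.
by rewrite card_walk_edges_cons // add1n ltnS.
Qed.

(** On a suitable suffix the tail is simple and the first vertex repeats. The tail has at most one
    more vertex than edges, and the first step adds an edge but no vertex. *)
Lemma bad_nonbacktracking s : sorted (fun x y => x != y) s ->
  nonbacktracking s -> ~~ uniq s -> bad s.
Proof.
elim: s => [|x [|y s] IH] // /andP[xy ps] /andP[xz nb].
rewrite cons_uniq negb_and negbK => H.
have [us|/IH] := boolP (uniq (y :: s)); last by move=> b; apply: bad_cons; apply: b.
have xs : x \in y :: s by move: H; rewrite us orbF.
rewrite /bad card_vertices_cons xs add0n (leq_trans (card_vertices_leq _ _)) //.
rewrite [walk_edges [:: x, y & s]]/= cardsU1 -add1n leq_add2r lt0b.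
move: xs; rewrite inE (negPf xy) /=; case: s xz us {IH ps nb H} => [|z s] //= xz us _.
(* The edge from [x] to [y] is new: it differs from the edge from [y] to [z] as [x] is neither, and
   a later occurrence would repeat [y] in the tail. *)
apply: contraL us; rewrite !inE => /orP[/eqP/setP/(_ x)|exy].
  by rewrite !inE eqxx (negPf xy) (negPf xz).
have := walk_edges_vertex (s := z :: s) exy (set22 x y).
by rewrite inE => H; rewrite H.
Qed.

End BadWalks.

(** * Counting bad walks from a vertex *)

Section CountBad.
Variables (V : finType) (G : sgraph V).
Local Notation adj := (adj G).
Local Notation dist := (dist G).
Implicit Types (x y z : V).

Definition nbad M x : nat := \sum_(s : M.-tuple V) (path adj x s && bad (x :: s)).

Definition nbad_upto N x : nat := \sum_(M < N.+1) nbad M x.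

Lemma leq_nbad_upto M N x : (M <= N)%N -> (nbad M x <= nbad_upto N x)%N.
Proof. by rewrite -ltnS => MN; rewrite /nbad_upto (bigD1 (Ordinal MN)) //= leq_addr. Qed.

Lemma nbad_upto_mono M N x : (M <= N)%N -> (nbad_upto M x <= nbad_upto N x)%N.
Proof.
move=> MN; rewrite /nbad_upto -!(big_mkord xpredT (nbad^~ x)).
by rewrite [leqRHS](big_cat_nat (n := M.+1)) //= leq_addr.
Qed.

Lemma nbad_cons M x : (\sum_(y | adj x y) nbad M y <= nbad M.+1 x)%N.
Proof.
rewrite /nbad big_tupleS big_mkcond; apply: leq_sum => y _.
case: ifP => // xy; apply: leq_sum => s _ /=; rewrite xy /=.
by case: (path _ _ _) => //=; case: (boolP (bad (y :: s))) => // /bad_cons ->.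
Qed.

Lemma nbad_upto_cons N x : (\sum_(y | adj x y) nbad_upto N y <= nbad_upto N.+1 x)%N.
Proof.
rewrite exchange_big [leqRHS]/nbad_upto big_ord_recl /=.
by rewrite -[leqLHS]add0n leq_add // leq_sum // => i _; apply: nbad_cons.
Qed.

(** Prefixing a bad walk from [y] with a geodesic from [x] keeps it bad; the induction adds the
    geodesic edge by edge. *)
Lemma nbad_upto_sphere j N x :
  (\sum_(y | dist x y == Some j) nbad_upto N y <= nbad_upto (N + j) x)%N.
Proof.
elim: j x => [|j IH] x.
  rewrite (big_pred1 x) ?addn0 // => y; apply/eqP/eqP => [/dist_eq0->//|->].
  exact: distxx.
rewrite addnS; apply: leq_trans (nbad_upto_cons _ _).
apply: (@leq_trans (\sum_(z | adj x z) \sum_(y | dist z y == Some j) nbad_upto N y)%N).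
  rewrite [leqRHS](exchange_big_dep predT) //= [leqLHS]big_mkcond; apply: leq_sum => y _.
  case: eqP => // /dist_first[z xz /eqP zy].
  by rewrite (bigD1 z) /= ?xz ?zy // leq_addr.
by apply: leq_sum.
Qed.

Lemma dist_pred x y j : dist x y = Some j.+1 -> exists2 z, adj z y & dist x z = Some j.
Proof.
rewrite dist_sym => /dist_first[z yz zx]; exists z; first by rewrite adjC.
by rewrite dist_sym.
Qed.

(** Distances to [x] fall along the walk, so it cannot backtrack. The condition on [u] says that [u]
    is not a candidate for the vertex following [y]. *)
Lemma geodesic_back x y j : dist x y = Some j ->
  exists s, [/\ size s = j, path adj y s, last y s = x &
    forall u, omap S (dist x u) != Some j -> nonbacktracking [:: u, y & s]].
Proof.
elim: j y => [|j IH] y Ey; first by rewrite (dist_eq0 Ey); exists [::].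
have [w wy Ew] := dist_pred Ey; have [s [sz ps ls nb]] := IH _ Ew.
exists (w :: s); split => /=; rewrite ?sz ?ls //; first by rewrite adjC wy.
move=> u Eu; have := nb y; rewrite Ey => /(_ _)/=.
move=> ->; last by apply/eqP => -[]; lia.
by rewrite andbT; apply: contraNneq Eu => ->; rewrite Ew.
Qed.

(* The geodesic from x to y followed by a walk back to x is closed, hence not
   uniq, and the condition on dist x z prevents backtracking at y. *)
Lemma closed_walk_bad x y j z t : dist x y = Some j ->
    path adj y (z :: t) -> nonbacktracking [:: y, z & t] ->
    omap S (dist x z) != Some j -> last z t = x ->
  exists s, [/\ size s = j, last x s = y, path adj x (s ++ z :: t) &
    bad (x :: s ++ z :: t)].
Proof.
elim: j y z t => [|j IH] y z t Ey.
  move: (dist_eq0 Ey) => <- pt nb _ lt; exists [::]; split => //=.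
  apply: bad_nonbacktracking nb _.
    by apply: sub_path pt => u v; exact: adj_neq.
  by rewrite cons_uniq negb_and negbK -{1}lt mem_last.
(* The walk is extended backwards by a predecessor [w] of [y], which differs from [z] because their
   distances from [x] differ. *)
move=> pt nb Ez lt; have [w wy Ew] := dist_pred Ey.
have [||||s [sz ls ps bs]] := IH w y (z :: t) Ew.
- by rewrite /= wy; exact: pt.
- rewrite [nonbacktracking _]/=; apply/andP; split; last exact: nb.
  by apply: contraNneq Ez => <-; rewrite Ew.
- by rewrite Ey /=; apply/eqP => -[]; lia.
- exact: lt.
by exists (rcons s y); rewrite size_rcons sz last_rcons cat_rcons.
Qed.

(** Two consecutive vertices are read off as a function of the walk, so distinct pairs come from
    distinct bad walks. *)
Lemma card_pairs_nbad i M x (Q : {set V * V}) :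
  (forall p, p \in Q -> exists s, [/\ size s = M, path adj x s, bad (x :: s) &
     (nth x (x :: s) i, nth x (x :: s) i.+1) = p]) -> (#|Q| <= nbad M x)%N.
Proof.
move=> H; pose B := [set s : M.-tuple V | path adj x s && bad (x :: s)]%SET.
have -> : nbad M x = #|B|.
  by rewrite /nbad -sum1_card [RHS]big_mkcond; apply: eq_bigr => s _; rewrite inE; case: (_ && _).
pose f (s : M.-tuple V) := (nth x (x :: s) i, nth x (x :: s) i.+1).
apply: leq_trans (leq_imset_card f B); apply/subset_leq_card/fintype.subsetP => p /H[s [sz ps bs <-]].
have szb : size s == M by apply/eqP.
by apply/imsetP; exists (Tuple szb); rewrite // inE /= ps bs.
Qed.

End CountBad.

(** * Degree sums over spheres *)

Lemma sum_card_pairs (T : finType) (A : {set T}) (N : T -> {set T}) :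
  (\sum_(y in A) #|N y| = #|[set q : T * T | (q.1 \in A) && (q.2 \in N q.1)]%SET|)%N.
Proof.
rewrite -[RHS]sum1_card (eq_bigl (fun q => (q.1 \in A) && (q.2 \in N q.1))).
  rewrite -(pair_big_dep (mem A) (fun y z => z \in N y) (fun _ _ => 1%N)) /=.
  by apply: eq_bigr => y _; rewrite sum1_card.
by move=> q; rewrite inE.
Qed.

Section Spheres.
Variables (V : finType) (G : sgraph V).
Local Notation adj := (adj G).
Local Notation dist := (dist G).
Implicit Types (x y z : V).

Definition sphere x j : {set V} := [set y | dist x y == Some j]%SET.

Lemma sphere1 x y : (y \in sphere x 1) = adj x y.
Proof.
rewrite inE; apply/eqP/idP => [/dist_first[z xz /dist_eq0 <-]//|].
exact: dist_adj.
Qed.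

Definition deg_into x i y : nat := #|sphere y 1 :&: sphere x i|%SET.

Lemma deg_into_pred x i y : dist x y = Some i.+1 -> (0 < deg_into x i y)%N.
Proof.
move=> /dist_pred[z zy xz]; apply/card_gt0P; exists z.
by rewrite finset.in_setI sphere1 adjC zy inE xz eqxx.
Qed.

(* Two distinct neighbours of y at distance i from x close up, through geodesics
   from x, to a bad walk in which y and the second neighbour are consecutive;
   one neighbour of each y is accounted for by the first summand. *)
Lemma deg_into_pred_leq x i :
  (\sum_(y in sphere x i.+1) deg_into x i y <= #|sphere x i.+1| + nbad G (i.+1).*2 x)%N.
Proof.
pose N y := (sphere y 1 :&: sphere x i)%SET.
(* By [pN] the default [y] is never taken on the sphere. *)
pose p y := odflt y [pick z in N y].
have pN y : y \in sphere x i.+1 -> p y \in N y.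
  rewrite inE => /eqP/deg_into_pred/card_gt0P[z zN]; rewrite /p.
  by case: pickP => [//|/(_ z)]; rewrite zN.
have -> : (\sum_(y in sphere x i.+1) deg_into x i y =
    #|sphere x i.+1| + \sum_(y in sphere x i.+1) #|N y :\ p y|)%N.
  rewrite -sum1_card -big_split; apply: eq_bigr => y yS /=.
  by rewrite /deg_into (cardsD1 (p y)) -/(N y) pN.
rewrite leq_add2l.
pose Q := [set q : V * V | (q.1 \in sphere x i.+1) && (q.2 \in N q.1 :\ p q.1)]%SET.
rewrite (sum_card_pairs _ (fun y => N y :\ p y)%SET) -/Q.
apply: (@card_pairs_nbad _ _ i.+1) => -[y z]; rewrite inE /= => /andP[yS].
rewrite in_setD1 => /andP[zp]; rewrite finset.in_setI sphere1 inE => /andP[yz /eqP Ez].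
have := pN _ yS; rewrite finset.in_setI sphere1 inE => /andP[yp /eqP Ep].
move: yS; rewrite inE => /eqP Ey.
have [s [ss ps ls nb]] := geodesic_back Ez.
(* The walk follows a geodesic to [p y], then [y], [z] and a geodesic back; [y] and [z] stand at
   positions [i.+1] and [i.+2]. *)
have [||||t [st lt pt bt]] := @closed_walk_bad V G x (p y) i y (z :: s) Ep.
- by rewrite /= adjC yp yz.
- rewrite [nonbacktracking _]/=; apply/andP; split; first by rewrite eq_sym.
  by apply: nb; rewrite Ey /=; apply/eqP => -[]; lia.
- by rewrite Ey /=; apply/eqP => -[]; lia.
- by [].
exists (t ++ y :: z :: s); split => //.
  by rewrite size_cat st /= ss -addnn addSnnS.
rewrite /= !nth_cat st ltnn subnn /=; case: i st {Ey Ez Ep ss nb pN N p Q zp yp lt pt bt} => [|i] st /=.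
  by [].
by rewrite ltnNge leqnSn /= subSnn.
Qed.

(** An edge inside a sphere closes up, through geodesics at both ends, to a bad walk of odd
    length. *)
Lemma deg_into_same_leq x i :
  (\sum_(y in sphere x i.+1) deg_into x i.+1 y <= nbad G (i.+1).*2.+1 x)%N.
Proof.
pose Q := [set q : V * V | (q.1 \in sphere x i.+1) && (q.2 \in sphere q.1 1 :&: sphere x i.+1)]%SET.
rewrite (sum_card_pairs _ (fun y => sphere y 1 :&: sphere x i.+1)%SET) -/Q.
apply: (@card_pairs_nbad _ _ i.+1) => -[y z]; rewrite inE /= => /andP[].
rewrite finset.in_setI sphere1 !inE => /eqP Ey /andP[yz /eqP Ez].
have [s [ss ps ls nb]] := geodesic_back Ez.
have ne : omap S (Some i.+1) != Some i.+1.
  by apply/eqP => -[]; lia.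
have [||||t [st lt pt bt]] := @closed_walk_bad V G x y i.+1 z s Ey.
- by rewrite /= yz.
- by apply: nb; rewrite Ey.
- by rewrite Ez.
- by [].
exists (t ++ z :: s); split => //.
  by rewrite size_cat st /= ss -addnn addnS.
rewrite /= !nth_cat st ltnn subnn /= ltnSn; congr pair.
by rewrite -lt (last_nth x) st.
Qed.

(** The triangle inequality, used in both directions, shows that distances of adjacent vertices from
    [x] differ by at most 1. *)
Lemma deg_split x i y : dist x y = Some i.+1 ->
  #|sphere y 1| = (deg_into x i y + deg_into x i.+1 y + deg_into x i.+2 y)%N.
Proof.
have cardE (A : {set V}) : #|A| = (\sum_z (z \in A))%N.
  by rewrite -sum1_card big_mkcond; apply: eq_bigr => z _; case: (z \in A).
move=> Ey; rewrite /deg_into !cardE -!big_split /=.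
apply: eq_bigr => z _; rewrite !finset.in_setI sphere1; case yz: (adj y z) => //=.
rewrite !inE.
have [a + Ea] := dist_triangle Ey (dist_adj yz).
have zy : adj z y by rewrite adjC.
have [b + Eb] := dist_triangle Ea (dist_adj zy).
rewrite Ea; move: Eb; rewrite Ey => -[<-]; rewrite !addn1 ltnS.
rewrite !(inj_eq (@Some_inj _)); lia.
Qed.

(** Edges between consecutive spheres are counted from the outer one, where [deg_into_pred_leq]
    applies. *)
Lemma sum_deg_sphere x i :
  (\sum_(y in sphere x i.+1) #|sphere y 1| =
    \sum_(y in sphere x i.+1) deg_into x i y + \sum_(y in sphere x i.+1) deg_into x i.+1 y
   + \sum_(z in sphere x i.+2) deg_into x i.+1 z)%N.
Proof.
rewrite (eq_bigr (fun y => deg_into x i y + deg_into x i.+1 y + deg_into x i.+2 y)%N); last first.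
  by move=> y; rewrite inE => /eqP; exact: deg_split.
rewrite !big_split /=; congr addn.
have E j k : (\sum_(y in sphere x j) deg_into x k y =
   \sum_(y in sphere x j) \sum_(z in sphere x k) adj y z)%N.
  apply: eq_bigr => y _; rewrite /deg_into -sum1_card big_mkcond [RHS]big_mkcond /=.
  by apply: eq_bigr => z _; rewrite finset.in_setI sphere1 andbC; case: (z \in _); case: adj.
rewrite !E exchange_big /=; apply: eq_bigr => z _; apply: eq_bigr => y _.
by rewrite adjC.
Qed.

(** The three error terms are the surplus predecessors in either sphere and the edges inside the
    inner one; [(i.+2).*2] bounds the lengths of all walks involved. *)
Lemma sum_deg_sphere_bounds x i :
  (#|sphere x i.+1| + #|sphere x i.+2| <= \sum_(y in sphere x i.+1) #|sphere y 1| <=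
   #|sphere x i.+1| + #|sphere x i.+2| + 3 * nbad_upto G (i.+2).*2 x)%N.
Proof.
have lb k : (#|sphere x k.+1| <= \sum_(y in sphere x k.+1) deg_into x k y)%N.
  rewrite -sum1_card; apply: leq_sum => y; rewrite inE => /eqP; exact: deg_into_pred.
have ub k : (k <= i.+1)%N -> (\sum_(y in sphere x k.+1) deg_into x k y <=
    #|sphere x k.+1| + nbad_upto G (i.+2).*2 x)%N.
  move=> ki; apply: leq_trans (deg_into_pred_leq x k) _; rewrite leq_add2l.
  by apply: leq_nbad_upto; rewrite leq_double.
rewrite sum_deg_sphere; apply/andP; split.
  by rewrite leq_add // (leq_trans (lb _)) // leq_addr.
have same := leq_trans (deg_into_same_leq x i) (@leq_nbad_upto _ _ _ (i.+2).*2 x _).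
have := leq_add (leq_add (ub i (leqnSn i)) (same _)) (ub i.+1 (leqnn _)).
rewrite [(i.+2).*2]doubleS ltnS => /(_ (leqnSn _)) /leq_trans; apply.
by rewrite -doubleS; apply/eq_leq; ring.
Qed.

End Spheres.

(** * Comparison with the tree weights *)

Section TreeWeight.
Variables (V : finType) (G : sgraph V).
Local Notation adj := (adj G).
Local Notation dist := (dist G).
Local Notation sphere := (sphere G).
Implicit Types (x y z : V).

Definition tree_weight l x : int :=
  if l is 0%N then 1 else (-1) ^+ l * #|sphere x 1|%:Z.

(** For positive [j], the failure of the degree identity that makes the recursion telescope on a
    tree. *)
Definition defect x j : int :=
  \sum_(y in sphere x j) #|sphere y 1|%:Z - #|sphere x j|%:Z - #|sphere x j.+1|%:Z.

Lemma tree_weight_defect l x :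
  tree_weight l.+1 x + \sum_(1 <= j < l.+2) \sum_(y in sphere x j) tree_weight (l.+1 - j) y =
  \sum_(1 <= j < l.+1) (-1) ^+ (l.+1 - j) * defect x j.
Proof.
rewrite big_nat_recr //= subnn /=.
have -> : \sum_(y in sphere x l.+1) (1 : int) = #|sphere x l.+1|%:Z.
  by rewrite sumr_const pmulrn intz.
(* Up to sign, the sphere sizes telescope: [a l.+1] cancels the term of [tree_weight 0] and [a 1] is
   the leading [tree_weight l.+1 x]. *)
pose a j : int := - (-1) ^+ (l.+1 - j) * #|sphere x j|%:Z.
have E : \sum_(1 <= j < l.+1) (a j.+1 - a j) = a l.+1 - a 1%N by rewrite telescope_sumr.
rewrite (eq_big_nat _ _ (F2 := fun j => (-1) ^+ (l.+1 - j) * defect x j + (a j.+1 - a j))).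
  rewrite big_split /= E /a subnn subSS subn0 exprS; ring.
move=> j /andP[j0 jl]; rewrite /defect /a subSS.
have -> : (l.+1 - j)%N = (l - j).+1 by rewrite subSn.
rewrite (eq_bigr (fun y => (-1) ^+ (l - j).+1 * #|sphere y 1|%:Z)) // -mulr_sumr exprS; ring.
Qed.

Definition weight_error l x : int := weight G l x - tree_weight l x.

Lemma weight_error0 x : weight_error 0 x = 0.
Proof. by rewrite /weight_error weight0 subrr. Qed.

Lemma weight_errorS l x : weight_error l.+1 x =
  - (\sum_(1 <= j < l.+1) \sum_(y in sphere x j) weight_error (l.+1 - j) y)
  - \sum_(1 <= j < l.+1) (-1) ^+ (l.+1 - j) * defect x j.
Proof.
rewrite -tree_weight_defect {1}/weight_error weightS opprD addrA addrAC; congr (_ - _).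
rewrite -opprD; congr (- _).
transitivity (\sum_(1 <= j < l.+2) \sum_(y in sphere x j)
   (weight_error (l.+1 - j) y + tree_weight (l.+1 - j) y)).
  apply: eq_bigr => j _; apply: eq_big => y; first by rewrite inE.
  by rewrite subrK.
under eq_bigr => j _ do rewrite big_split /=.
rewrite big_split /= [X in X + _ = _]big_nat_recr //= subnn.
rewrite [X in _ + X + _]big1 ?addr0 // => y _; exact: weight_error0.
Qed.

Lemma norm_defect i x : `|defect x i.+1| <= (3 * nbad_upto G (i.+2).*2 x)%N%:Z.
Proof.
rewrite /defect -(big_morph _ PoszD (erefl _)).
case/andP: (sum_deg_sphere_bounds G x i).
move: (\sum_(_ in _) _)%N #|_| #|_| (nbad_upto _ _ _) => a b c d; lia.
Qed.

End TreeWeight.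

(** Strong induction on the length through [weight_errorS]; the constant depends on [l] alone, which
    makes the bound usable under expectation. *)
Lemma weight_error_bound l : exists C : nat, forall (V : finType) (G : sgraph V) x,
  `|weight_error G l x| <= (C * nbad_upto G l.*2 x)%N%:Z.
Proof.
suff [C HC] : exists C : nat, forall k, (k <= l)%N -> forall (V : finType) (G : sgraph V) x,
    `|weight_error G k x| <= (C * nbad_upto G k.*2 x)%N%:Z.
  by exists C; apply: HC.
elim: l => [|l [C HC]].
  by exists 0%N => k; rewrite leqn0 => /eqP -> V G x; rewrite weight_error0 normr0.
(* Each of the [l] spheres costs [C] by induction and 3 for its defect; the last [C] covers the
   smaller lengths. *)
exists (l * (C + 3) + C)%N => k; rewrite leq_eqVlt => /orP[/eqP->|kl] V G x; last first.
  by apply: le_trans (HC k kl _ G x) _; rewrite lez_nat leq_mul2r leq_addl orbT.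
rewrite weight_errorS (le_trans (ler_normB _ _)) // normrN.
have H1 : `|\sum_(1 <= j < l.+1) \sum_(y in sphere G x j) weight_error G (l.+1 - j) y|
    <= (l * C * nbad_upto G (l.+1).*2 x)%N%:Z.
  apply: le_trans (ler_norm_sum _ _ _) _.
  have -> : (l * C * nbad_upto G (l.+1).*2 x)%N%:Z =
      \sum_(1 <= j < l.+1) (C * nbad_upto G (l.+1).*2 x)%N%:Z.
    by rewrite sumr_const_nat subn1 -mulr_natl natz -PoszM mulnA.
  apply: ler_sum_nat => j /andP[j0 jl]; apply: le_trans (ler_norm_sum _ _ _) _.
  apply: (@le_trans _ _ (\sum_(y in sphere G x j) (C * nbad_upto G (l.+1 - j).*2 y)%N%:Z)).
    by apply: ler_sum => y _; apply: HC; lia.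
  rewrite -(big_morph _ PoszD (erefl _)) lez_nat -big_distrr leq_mul2l /=; apply/orP; right.
  apply: (@leq_trans (nbad_upto G ((l.+1 - j).*2 + j) x)); last by apply: nbad_upto_mono; lia.
  apply: leq_trans (nbad_upto_sphere _ _ _ _); apply/eq_leq; apply: eq_bigl => y.
  by rewrite inE.
have H2 : `|\sum_(1 <= j < l.+1) (-1) ^+ (l.+1 - j) * defect G x j|
    <= (l * 3 * nbad_upto G (l.+1).*2 x)%N%:Z.
  apply: le_trans (ler_norm_sum _ _ _) _.
  have -> : (l * 3 * nbad_upto G (l.+1).*2 x)%N%:Z =
      \sum_(1 <= j < l.+1) (3 * nbad_upto G (l.+1).*2 x)%N%:Z.
    by rewrite sumr_const_nat subn1 -mulr_natl natz -PoszM mulnA.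
  apply: ler_sum_nat => -[|j] // /andP[_ jl]; rewrite normrM normrX normrN1 expr1n mul1r.
  apply: le_trans (norm_defect _ _ _) _; rewrite lez_nat leq_mul2l /=.
  by apply: nbad_upto_mono; rewrite leq_double.
apply: le_trans (lerD H1 H2) _; rewrite -PoszD lez_nat -mulnDl leq_mul2r; apply/orP; right.
by rewrite -mulnDr leq_addr.
Qed.

Lemma chi_error_bound l : (0 < l)%N -> exists C : nat, forall (V : finType) (G : sgraph V),
  `|chi G l - (-1) ^+ l * (\sum_x #|sphere G x 1|)%N%:Z| <=
     (C * \sum_x nbad_upto G l.*2 x)%N%:Z.
Proof.
move=> l0; have [C HC] := weight_error_bound l; exists C => V G.
have -> : chi G l - (-1) ^+ l * (\sum_x #|sphere G x 1|)%N%:Z = \sum_x weight_error G l x.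
  rewrite chi_weight (big_morph _ PoszD (erefl _)) mulr_sumr -sumrB.
  by case: l l0 {HC}.
apply: le_trans (ler_norm_sum _ _ _) _; rewrite big_distrr (big_morph _ PoszD (erefl _)) /=.
exact: ler_sum.
Qed.

(** * Moments in the random graph *)

Section ErdosRenyi.
Variables (R : realType) (n : nat) (p : R).
Local Notation V := 'I_n.
Local Notation E := (ER_expectation p).
Implicit Types (X Y : sgraph V -> R) (A : {set {set V}}).

Lemma sum_sgraph (F : {set {set V}} -> R) :
  \sum_(G : sgraph V) F (edges G) = \sum_(J : {set {set V}} | J \subset vpairs V) F J.
Proof.
rewrite [RHS](reindex_omap (@edges V) insub) => [|J JV]; last first.
  by rewrite /= insubT.
apply: eq_bigl => G; rewrite edgesP /= valK eqxx //.
Qed.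

(** Independence: the product of sums [f e + g e] expands over edge sets [J], and only those between
    [A] and [vpairs V] survive, since [f] vanishes off [vpairs V] and [g] on [A]. *)
Lemma ER_expectation_subset A : A \subset vpairs V ->
  E (fun G => (A \subset edges G)%:R) = p ^+ #|A|.
Proof.
move=> AV; pose f e : R := if e \in vpairs V then p else 0.
pose g e : R := if e \in vpairs V then (if e \in A then 0 else 1 - p) else 1.
transitivity (\prod_e (f e + g e)); last first.
  rewrite -prodr_const [RHS]big_mkcond /=; apply: eq_bigr => e _; rewrite /f /g.
  case: (boolP (e \in A)) => eA; first by rewrite (fintype.subsetP AV _ eA) addr0.
  by case: ifP => _; rewrite ?add0r // addrC subrK.
rewrite bigA_distr /= /ER_expectation /ER_mass.
rewrite (sum_sgraph (fun J => (\prod_(e in vpairs V) (if e \in J then p else 1 - p)) * (A \subset J)%:R)).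
rewrite big_mkcond /=; apply: eq_big => [J|J _] //.
case: (boolP (J \subset vpairs V)) => JV; last first.
  by case/fintype.subsetPn: JV => e eJ eV; rewrite (bigD1 e) //= eJ /f (negPf eV) mul0r.
case: (boolP (A \subset J)) => AJ; last first.
  case/fintype.subsetPn: AJ => e eA eJ; rewrite mulr0 (bigD1 e) //= (negPf eJ) /g.
  by rewrite (fintype.subsetP AV _ eA) eA mul0r.
rewrite mulr1 [LHS]big_mkcond; apply: eq_bigr => e _; rewrite /f /g.
case: (boolP (e \in vpairs V)) => eV; last first.
  by case: ifP => // eJ; rewrite (fintype.subsetP JV _ eJ) in eV.
case: ifPn => // eJ; case: ifP => // eA.
by rewrite (fintype.subsetP AJ _ eA) in eJ.
Qed.

Lemma ER_expectation1 : E (fun _ : sgraph V => 1) = 1.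
Proof.
have := @ER_expectation_subset finset.set0 (finset.sub0set _); rewrite cards0 expr0 => E0.
by rewrite -[RHS]E0; apply: eq_bigr => G _; rewrite finset.sub0set.
Qed.

Lemma ER_expectation_sum (I : finType) (P : pred I) (F : I -> sgraph V -> R) :
  E (fun G => \sum_(i | P i) F i G) = \sum_(i | P i) E (F i).
Proof.
by rewrite exchange_big; apply: eq_bigr => G _; rewrite mulr_sumr.
Qed.

Lemma eq_ER_expectation X Y : X =1 Y -> E X = E Y.
Proof. by move=> XY; apply: eq_bigr => G _; rewrite XY. Qed.

Lemma ER_expectationD X Y : E (fun G => X G + Y G) = E X + E Y.
Proof. by rewrite -big_split; apply: eq_bigr => G _; rewrite mulrDr. Qed.

Lemma ER_expectationZ a X : E (fun G => a * X G) = a * E X.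
Proof. by rewrite mulr_sumr; apply: eq_bigr => G _; rewrite mulrCA. Qed.

Hypothesis p01 : 0 <= p <= 1.

Lemma ER_mass_ge0 (G : sgraph V) : 0 <= ER_mass p G.
Proof. by case/andP: p01 => p0 p1; apply: prodr_ge0 => e _; case: ifP => // _; rewrite subr_ge0. Qed.

Lemma ler_ER_expectation X Y : (forall G, X G <= Y G) -> E X <= E Y.
Proof. by move=> XY; apply: ler_sum => G _; rewrite ler_wpM2l // ER_mass_ge0. Qed.

Lemma ler_norm_ER_expectation X : `|E X| <= E (fun G => `|X G|).
Proof.
apply: le_trans (ler_norm_sum _ _ _) _; apply: ler_sum => G _.
by rewrite normrM ger0_norm // ER_mass_ge0.
Qed.

(** Markov's inequality: [X] dominates the indicator of [A]. *)
Lemma ER_probability_leq (A : pred (sgraph V)) X : (forall G, 0 <= X G) ->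
  (forall G, A G -> 1 <= X G) -> ER_probability p A <= E X.
Proof.
move=> X0 X1; rewrite /ER_probability big_mkcond; apply: ler_sum => G _.
case: ifP => AG; last by rewrite mulr_ge0 // ER_mass_ge0.
by rewrite ler_peMr ?X1 // ER_mass_ge0.
Qed.

Lemma path_walk_edges (G : sgraph V) x s : path (adj G) x s -> walk_edges (x :: s) \subset edges G.
Proof.
elim: s x => [|y s IH] x /=; first by rewrite finset.sub0set.
by case/andP=> xy /IH H; rewrite finset.subUset finset.sub1set [_ \in _]xy.
Qed.

(* A vertex prepended to a sequence of length m either repeats one of at most m
   vertices or is one of at most n new ones, at the cost of a factor p. *)
Lemma sum_vertices_leq m :
  \sum_(s : m.-tuple V) p ^+ #|[set x in s]%SET| <= \prod_(i < m) (i%:R + n%:R * p).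
Proof.
case/andP: (p01) => p0 p1; elim: m => [|m IH].
  rewrite big_ord0 (big_pred1 [tuple]) => [|s]; last by apply/esym/eqP/val_inj; rewrite tuple0.
  exact: exprn_ile1.
rewrite big_tupleS exchange_big big_ord_recr /=.
have mnp : 0 <= m%:R + n%:R * p by rewrite addr_ge0 // mulr_ge0.
apply: le_trans (ler_wpM2r mnp IH); rewrite mulr_suml; apply: ler_sum => s _.
rewrite (eq_bigr (fun x => p ^+ #|[set y in s]%SET| * p ^+ (x \notin s))); last first.
  by move=> x _; rewrite -exprD addnC -card_vertices_cons; congr (_ ^+ _).
rewrite -mulr_sumr ler_wpM2l ?exprn_ge0 //.
apply: (@le_trans _ _ (\sum_(x : V) ((x \in s)%:R + p))).
  by apply: ler_sum => x _; case: (x \in s); rewrite /= ?expr0 ?expr1 ?lerDl ?add0r.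
rewrite big_split /= sumr_const card_ord -[p *+ n]mulr_natl lerD2r -natr_sum ler_nat.
have -> : (\sum_(x : V) (x \in s) = #|s|)%N.
  by rewrite -sum1_card [RHS]big_mkcond; apply: eq_bigr => x _; case: (x \in s).
by rewrite (leq_trans (card_size _)) // size_tuple.
Qed.

(** A bad walk on $v$ vertices needs at least $v$ edges, so it is present with probability at most
    $p^v$; [sum_vertices_leq] sums this over all vertex sequences. *)
Lemma ER_expectation_nbad M :
  E (fun G : sgraph V => (\sum_x nbad G M x)%N%:R) <= \prod_(i < M.+1) (i%:R + n%:R * p).
Proof.
case/andP: (p01) => p0 p1; apply: le_trans (sum_vertices_leq _).
rewrite big_tupleS.
apply: (@le_trans _ _ (E (fun G : sgraph V => \sum_x \sum_(s : M.-tuple V)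
    (bad (x :: s) && (walk_edges (x :: s) \subset edges G))%:R))).
  apply: ler_ER_expectation => G; rewrite natr_sum; apply: ler_sum => x _.
  rewrite natr_sum; apply: ler_sum => s _; rewrite ler_nat.
  by case: (boolP (path _ _ _)) => //= /path_walk_edges H; rewrite [X in _ && X]H andbT.
rewrite ER_expectation_sum; apply: ler_sum => x _; rewrite ER_expectation_sum.
apply: ler_sum => s _.
have [b|nb] := boolP (bad (x :: s)); last first.
  by rewrite /ER_expectation big1 ?exprn_ge0 // => G _; rewrite mulr0.
(* A sequence that repeats a vertex consecutively yields a singleton instead of an edge and is a
   walk in no graph. *)
have [EV|nEV] := boolP (walk_edges (x :: s) \subset vpairs V); last first.
  rewrite /ER_expectation big1 ?exprn_ge0 // => G _ /=.
  case: (boolP (_ \subset edges G)) => [H|]; last by rewrite mulr0.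
  by case/negP: nEV; apply: fintype.subset_trans H (edgesP G).
rewrite (ER_expectation_subset EV); exact: ler_wiXn2l.
Qed.

Lemma ER_expectation_nbad_upto N :
  E (fun G : sgraph V => (\sum_x nbad_upto G N x)%N%:R) <= \sum_(M < N.+1) \prod_(i < M.+1) (i%:R + n%:R * p).
Proof.
apply: le_trans (ler_sum _ (fun M _ => ER_expectation_nbad _)).
rewrite -ER_expectation_sum; apply: ler_ER_expectation => G.
by rewrite exchange_big natr_sum.
Qed.

(** * First and second moments of the degree sum *)

Definition degree_sum (G : sgraph V) : nat := \sum_x #|sphere G x 1|.

Definition edge_of (q : V * V) : {set V} := [set q.1; q.2]%SET.

Lemma degree_sumE G : (degree_sum G)%:R =
  \sum_(q : V * V | q.1 != q.2) (edge_of q \in edges G)%:R :> R.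
Proof.
transitivity (\sum_(x : V) \sum_(y : V)
    (if x != y then (edge_of (x, y) \in edges G)%:R else 0 : R)); last first.
  by rewrite pair_bigA [RHS]big_mkcond; apply: eq_bigr => -[].
rewrite /degree_sum natr_sum; apply: eq_bigr => x _.
rewrite -sum1_card natr_sum [LHS]big_mkcond; apply: eq_bigr => y _ /=.
rewrite sphere1 /edge_of /= -/(adj G x y); case: ifP => [/adj_neq ->//|_].
by rewrite if_same.
Qed.

Lemma edge_of_vpairs q : q.1 != q.2 -> edge_of q \in vpairs V.
Proof. by move=> q12; rewrite inE cards2 q12. Qed.

Lemma card_offdiag : #|[pred q : V * V | q.1 != q.2]| = (n * n.-1)%N.
Proof.
rewrite -sum1_card (eq_bigl (fun q : V * V => predT q.1 && (q.1 != q.2))) //.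
rewrite -(pair_big_dep predT (fun x y : V => x != y) (fun _ _ => 1%N)) /=.
rewrite (eq_bigr (fun=> n.-1)) ?sum_nat_const ?card_ord // => x _.
rewrite sum1_card -[in RHS](card_ord n) -(cardC1 x).
by apply: eq_card => y; rewrite !inE eq_sym.
Qed.

Lemma ER_expectation_degree_sum : E (fun G => (degree_sum G)%:R) = (n * n.-1)%:R * p.
Proof.
rewrite (@eq_ER_expectation _ (fun G =>
    \sum_(q : V * V | q.1 != q.2) ([set edge_of q]%SET \subset edges G)%:R)).
  rewrite [LHS]ER_expectation_sum (eq_bigr (fun=> p)).
    by rewrite sumr_const card_offdiag mulr_natl.
  move=> q q12; rewrite ER_expectation_subset ?cards1 //.
  by rewrite finset.sub1set edge_of_vpairs.
move=> G; rewrite degree_sumE; apply: eq_bigr => q _.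
by rewrite finset.sub1set.
Qed.

(** Ordered pairs [q] and [r] with different edges contribute $p^2$; only [q] and its reversal share
    the edge of [q], which gives the term with factor 2. *)
Lemma ER_expectation_degree_sum2 :
  E (fun G => (degree_sum G)%:R ^+ 2) <= ((n * n.-1)%:R * p) ^+ 2 + 2 * ((n * n.-1)%:R * p).
Proof.
case/andP: (p01) => p0 p1.
rewrite (@eq_ER_expectation _ (fun G => \sum_(q : V * V | q.1 != q.2)
   \sum_(r : V * V | r.1 != r.2) ([set edge_of q; edge_of r]%SET \subset edges G)%:R)); last first.
  move=> G; rewrite degree_sumE expr2 mulr_suml; apply: eq_bigr => q _.
  rewrite mulr_sumr; apply: eq_bigr => r _.
  by rewrite finset.subUset !finset.sub1set -natrM mulnb.
rewrite [leLHS]ER_expectation_sum.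
apply: (@le_trans _ _ (\sum_(q : V * V | q.1 != q.2) ((n * n.-1)%:R * p ^+ 2 + 2 * p))); last first.
  by rewrite sumr_const card_offdiag -[leLHS]mulr_natl; rewrite le_eqVlt; apply/orP; left; apply/eqP; ring.
apply: ler_sum => q q12; rewrite ER_expectation_sum.
apply: (@le_trans _ _ (\sum_(r : V * V | r.1 != r.2) (p ^+ 2 + (edge_of r == edge_of q)%:R * p))).
  apply: ler_sum => r r12; rewrite ER_expectation_subset; last first.
    by rewrite finset.subUset !finset.sub1set !edge_of_vpairs.
  rewrite cards2 eq_sym; case: eqP => _ /=; last by rewrite mul0r addr0.
  by rewrite mul1r expr1 lerDr exprn_ge0.
rewrite big_split /= sumr_const card_offdiag -[p ^+ 2 *+ _]mulr_natl lerD2l -mulr_suml ler_wpM2r //.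
rewrite -natr_sum ler_nat.
apply: (@leq_trans #|[set q; (q.2, q.1)]%SET|); last by rewrite cards2; case: (_ != _).
rewrite -sum1_card big_mkcond [leqRHS]big_mkcond /=; apply: leq_sum => r _.
case: ifP => // r12; case: eqP => // Er.
suff -> : r \in [set q; (q.2, q.1)]%SET by [].
case: q q12 r r12 Er => [a b] /= ab [c d] /= cd; rewrite /edge_of /= => /setP Er.
move: (Er c) (Er d); rewrite !inE !eqxx orbT /= !xpair_eqE.
move=> /esym/orP[]/eqP Ec /esym/orP[]/eqP Ed; subst; rewrite ?eqxx ?orbT // in cd *.
Qed.

End ErdosRenyi.

(** * The sparse regime *)

Lemma cvg_of_dist_leq_divn (R : realType) (u : nat -> R) (a K : R) (n0 : nat) :
  (forall n, (n0 < n)%N -> `|u n - a| <= K / n%:R) -> u @ \oo --> a.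
Proof.
move=> H; apply/cvgrPdist_le => e e0; near=> n.
have n0n : (n0 < n)%N by near: n; exact: nbhs_infty_gt.
rewrite distrC (le_trans (H n n0n)) // ler_pdivrMr ?ltr0n ?(leq_ltn_trans _ n0n) //.
by rewrite mulrC -ler_pdivrMr //; near: n; exact: nbhs_infty_ger.
Unshelve. all: by end_near. Qed.

Section Sparse.
Variables (R : realType) (l : nat) (c : R).
Hypotheses (l_gt0 : (0 < l)%N) (c_gt0 : 0 < c).
Local Notation chiR G := ((chi G l)%:~R : R).

Lemma sparse_p01 n : c < n%:R -> 0 <= c / n%:R <= 1.
Proof.
move=> cn; have n0 : 0 < n%:R :> R by apply: lt_trans cn.
by apply/andP; split; rewrite ?divr_ge0 ?ler_pdivrMr ?mul1r // ltW.
Qed.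

(** For $p=c/n$ the factors $i+np$ become $i+c$, so the expected number of bad walks is bounded
    uniformly in $n$. *)
Lemma sparse_chi_error : exists2 K : R, 0 <= K & forall n, c < n%:R ->
  ER_expectation (c / n%:R) (fun G : sgraph 'I_n =>
    `|chiR G - (-1) ^+ l * (degree_sum G)%:R|) <= K.
Proof.
have [C HC] := chi_error_bound l_gt0.
exists (C%:R * \sum_(M < (l.*2).+1) \prod_(i < M.+1) (i%:R + c)).
  by rewrite mulr_ge0 // sumr_ge0 // => M _; rewrite prodr_ge0 // => i _; rewrite addr_ge0 // ltW.
move=> n cn; have p01 := sparse_p01 cn.
have n0 : n%:R != 0 :> R by rewrite gt_eqF // (lt_trans c_gt0).
have := ER_expectation_nbad_upto n p01 l.*2.
rewrite [X in _ <= X -> _](eq_bigr (fun M : 'I__ => \prod_(i < M.+1) (i%:R + c))); last first.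
  by move=> M _; apply: eq_bigr => i _; rewrite mulrCA divff // mulr1.
move=> /(ler_wpM2l (ler0n R C)); apply: le_trans; rewrite -ER_expectationZ.
apply: ler_ER_expectation => // G; rewrite -natrM.
have := HC _ G; rewrite -(ler_int R) intr_norm rmorphB rmorphM rmorphXn rmorphN1.
exact.
Qed.

Lemma sparse_degree_sum n : c < n%:R ->
  ER_expectation (c / n%:R) (fun G : sgraph 'I_n => (degree_sum G)%:R) = (n%:R - 1) * c.
Proof.
move=> cn; rewrite ER_expectation_degree_sum; case: n cn => [|n] cn.
  by move: (lt_trans c_gt0 cn); rewrite ltxx.
by rewrite natrM mulrC mulrACA -mulrA mulVKf ?pnatr_eq0 //= -natr1; ring.
Qed.

(** The second moment is taken about $nc$ instead of the mean $(n-1)c$; the shift accounts for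
    $c^2$. *)
Lemma sparse_degree_sum_variance n : c < n%:R ->
  ER_expectation (c / n%:R) (fun G : sgraph 'I_n => ((degree_sum G)%:R - n%:R * c) ^+ 2)
    <= c ^+ 2 + 2 * c * n%:R.
Proof.
move=> cn; have p01 := sparse_p01 cn.
have EZ := sparse_degree_sum cn.
have := ER_expectation_degree_sum2 n p01.
rewrite -(ER_expectation_degree_sum n (c / n%:R)) EZ => EZ2.
rewrite (@eq_ER_expectation _ _ _ _ (fun G => ((degree_sum G)%:R ^+ 2 +
   (- (2 * (n%:R * c))) * (degree_sum G)%:R) + (n%:R * c) ^+ 2 * 1)); last first.
  by move=> G; ring.
rewrite !ER_expectationD !ER_expectationZ ER_expectation1 EZ.
apply: le_trans (lerD (lerD EZ2 (lexx _)) (lexx _)) _.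
rewrite [leLHS](_ : _ = c ^+ 2 + 2 * c * n%:R - 2 * c); last by ring.
by rewrite lerBlDr lerDl mulr_ge0 // ltW.
Qed.

Lemma sparse_expectation_bound : exists K, forall n, c < n%:R ->
  `|ER_expectation (c / n%:R) (fun G : sgraph 'I_n => chiR G) / n%:R - (-1) ^+ l * c| <= K / n%:R.
Proof.
(* The extra [c] pays for the mean $(n-1)c$ in place of $nc$. *)
have [K K0 HK] := sparse_chi_error; exists (K + c) => n cn; have p01 := sparse_p01 cn.
have n0 : 0 < n%:R :> R by apply: lt_trans cn.
have -> : ER_expectation (c / n%:R) (fun G : sgraph 'I_n => chiR G) =
    ER_expectation (c / n%:R) (fun G : sgraph 'I_n => chiR G - (-1) ^+ l * (degree_sum G)%:R)
    + (-1) ^+ l * ((n%:R - 1) * c).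
  rewrite -(sparse_degree_sum cn) -ER_expectationZ -ER_expectationD.
  by apply: eq_ER_expectation => G; rewrite subrK.
set e := ER_expectation _ _.
have -> : (e + (-1) ^+ l * ((n%:R - 1) * c)) / n%:R - (-1) ^+ l * c = (e - (-1) ^+ l * c) / n%:R.
  by field; rewrite gt_eqF.
rewrite normrM [X in _ * X]ger0_norm ?invr_ge0 // ler_wpM2r ?invr_ge0 //.
rewrite (le_trans (ler_normB _ _)) // lerD //.
  exact: le_trans (ler_norm_ER_expectation p01 _) (HK n cn).
by rewrite normrM normrX normrN1 expr1n mul1r gtr0_norm.
Qed.

Lemma sparse_probability_bound (eps : R) : 0 < eps -> exists K, forall n, c < n%:R ->
  `|ER_probability (c / n%:R) (fun G : sgraph 'I_n =>
     eps < `|chiR G / n%:R - (-1) ^+ l * c|) - 0| <= K / n%:R.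
Proof.
move=> e0; have [K K0 HK] := sparse_chi_error.
exists (2 / eps * K + (2 / eps) ^+ 2 * (c ^+ 2 + 2 * c)) => n cn.
have p01 := sparse_p01 cn.
have n0 : 0 < n%:R :> R by apply: lt_trans cn.
have n1 : 1 <= n%:R :> R by move: n0; rewrite ltr0n ler1n.
rewrite subr0 ger0_norm; last by apply: sumr_ge0 => G _; exact: ER_mass_ge0.
(* On the event, one of the two deviations is at least half of [eps * n%:R]; the summands of [X] are
   the Markov and Chebyshev bounds for the two cases. *)
pose X (G : sgraph 'I_n) := (2 / (eps * n%:R)) * `|chiR G - (-1) ^+ l * (degree_sum G)%:R| +
  (2 / (eps * n%:R)) ^+ 2 * ((degree_sum G)%:R - n%:R * c) ^+ 2.
have en0 : 0 < eps * n%:R by rewrite mulr_gt0.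
apply: (@le_trans _ _ (ER_expectation (c / n%:R) X)).
  apply: ER_probability_leq => // G.
    by rewrite addr_ge0 // mulr_ge0 ?sqr_ge0 // divr_ge0 // ltW.
  move=> big; rewrite /X; set a := `|_ - _|; set b := _ - n%:R * c.
  have ab : eps * n%:R < a + `|b|.
    move: big; rewrite -(ltr_pM2r n0) => /lt_le_trans; apply.
    rewrite -[X in _ * X](ger0_norm (ltW n0)) -normrM.
    have -> : (chiR G / n%:R - (-1) ^+ l * c) * n%:R =
       (chiR G - (-1) ^+ l * (degree_sum G)%:R) + (-1) ^+ l * b.
      by rewrite /b; field; rewrite gt_eqF.
    by rewrite (le_trans (ler_normD _ _)) // lerD2l normrM normrX normrN1 expr1n mul1r.
  rewrite -[b ^+ 2]real_normK ?num_real // -exprMn.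
  have a0 : 0 <= a := normr_ge0 _.
  have [ha|ha] := lerP (eps * n%:R) (2 * a).
    by rewrite -[leLHS]addr0 lerD ?sqr_ge0 // mulrAC ler_pdivlMr // mul1r.
  have hb : eps * n%:R <= 2 * `|b| by lra.
  have hb1 : 1 <= 2 / (eps * n%:R) * `|b| by rewrite mulrAC ler_pdivlMr // mul1r.
  rewrite -[leLHS]add0r lerD //; first by rewrite mulr_ge0 // divr_ge0 // ltW.
  by rewrite exprn_ege1.
rewrite /X ER_expectationD !ER_expectationZ [leRHS]mulrDl lerD //.
  rewrite [leRHS](_ : _ = 2 / (eps * n%:R) * K); last by field; rewrite !gt_eqF.
  by rewrite ler_wpM2l ?divr_ge0 ?(ltW en0) // HK.
(* Since $n\ge1$, the constant $c^2$ is absorbed into $c^2n$. *)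
apply: (@le_trans _ _ ((2 / (eps * n%:R)) ^+ 2 * (c ^+ 2 * n%:R + 2 * c * n%:R))).
  rewrite ler_wpM2l ?sqr_ge0 // (le_trans (sparse_degree_sum_variance cn)) // lerD2r.
  by rewrite ler_peMr ?sqr_ge0.
by rewrite le_eqVlt; apply/orP; left; apply/eqP; field; rewrite !gt_eqF.
Qed.

End Sparse.

Theorem corollary1p11 (R : realType) (l : nat) (c : R) :
  (1 <= l)%N -> 0 < c ->
  ((fun n : nat =>
      ER_expectation (c / n%:R) (fun G : sgraph 'I_n => (chi G l)%:~R) / n%:R)
     @ \oo --> (-1) ^+ l * c) /\
  (forall eps : R, 0 < eps ->
     (fun n : nat =>
        ER_probability (c / n%:R)
          (fun G : sgraph 'I_n => eps < `| (chi G l)%:~R / n%:R - (-1) ^+ l * c |))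
       @ \oo --> (0 : R)).
Proof.
move=> l_gt0 c_gt0.
(* Past this threshold $c/n$ is a genuine probability, as the bounds require. *)
have large n : (Num.bound c < n)%N -> c < n%:R.
  by move=> cn; apply: lt_trans (archi_boundP (ltW c_gt0)) _; rewrite ltr_nat.
split=> [|eps eps_gt0].
  have [K HK] := sparse_expectation_bound l_gt0 c_gt0.
  by apply: cvg_of_dist_leq_divn => n /large; apply: HK.
have [K HK] := sparse_probability_bound l_gt0 c_gt0 eps_gt0.
by apply: cvg_of_dist_leq_divn => n /large; apply: HK.
Qed.
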